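(* The functor $$[1]:\mathcal{V}ect\to 1\text{-}\mathcal{M}an,\qquad (E\to M)\mapsto E[1],$$ from the category of vector bundles to the category of $\mathbb{N}$-graded manifolds of degree $1$ is an equivalence of categories.
   Context: An $\mathbb{N}$-graded manifold of degree $1$ (a $1$-manifold) of dimension $m_0|m_1$ is a pair $\mathcal{M}=(M,C_\bullet(\mathcal{M}))$ where $M$ is a smooth manifold of dimension $m_0$ and $C_\bullet(\mathcal{M})$ is a sheaf of graded-commutative ($\mathbb{R}$-)algebras on $M$ such that every $p\in M$ has an open neighbourhood $U$ with $C_\bullet(\mathcal{M})_{|U}\cong C^\infty(U)\otimes\wedge^\bullet\mathbb{R}^{m_1}$, the elements of $\mathbb{R}^{m_1}$ having degree $1$. A morphism $\Psi:\mathcal{M}\to\mathcal{N}$ is a morphism of ringed spaces $\Psi=(\psi,\psi^\sharp)$, with $\psi:M\to N$ smooth and $\psi^\sharp:C_\bullet(\mathcal{N})\to\psi_*C_\bullet(\mathcal{M})$ a degree-preserving morphism of sheaves of algebras over $N$. These form the category $1\text{-}\mathcal{M}an$. $\mathcal{V}ect$ is the category whose objects are smooth vector bundles $E\to M$ (over varying bases) and whose morphisms are vector bundle morphisms $\Phi:E\to F$ covering a smooth map $\varphi:M\to N$ of the bases. For a vector bundle $E\to M$, $E[1]=(M,\,C_\bullet(E[1])=\Gamma(\wedge^\bullet E^* ))$. For a vector bundle morphism $\Phi:E\to F$ covering $\varphi$, $\Phi[1]=(\varphi,\wedge^\bullet\Phi^\sharp):E[1]\to F[1]$, where $\wedge^l\Phi^\sharp:\Gamma(\wedge^lF^*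 )\to\varphi_*\Gamma(\wedge^lE^* )$ is the pull-back $s\mapsto \wedge^l\Phi^*\circ s\circ\varphi$. *)

(* Defs.v *)
From HB Require Import structures.
From mathcomp Require Import all_boot all_order all_algebra.
From mathcomp Require Import boolp classical_sets functions cardinality reals.
From mathcomp Require Import topology normedtype landau derive.
From mathcomp Require Import ring lra.
Set Implicit Arguments.
Unset Strict Implicit.
Unset Printing Implicit Defensive.
Import Order.TTheory GRing.Theory Num.Theory numFieldNormedType.Exports.
Local Open Scope classical_set_scope.
Local Open Scope ring_scope.

Section Euclidean.
Variables (R : realType) (n : nat).
Implicit Types (U : set 'rV[R]_n) (f g : 'rV[R]_n -> R).

(* f is k times continuously differentiable on U. Meant for U open: then it
   says that f is differentiable with partial derivatives of class C^(k-1). *)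
Fixpoint Ck (k : nat) U f : Prop :=
  match k with
  | 0 => forall x, U x -> {for x, continuous f}
  | k.+1 => (forall x, U x -> differentiable f x) /\
            forall i : 'I_n, Ck k U ('D_(delta_mx 0 i) f)
  end.

Definition Cinf U f : Prop := forall k, Ck k U f.

Lemma differentiable_near0 f x : (\near x, f x = 0) -> differentiable f x.
Proof.
move=> fx; have f0 : f x = 0 by exact: nbhs_singleton fx.
have key : f \o shift x = cst (f x) + cst 0 +o_ (0 : 'rV[R]_n) id.
  rewrite f0; apply: eqaddoE; rewrite -[LHS]add0r; congr (_ + _).
    by rewrite funeqE => y /=; rewrite [RHS]addr0.
  apply/eqoP => e e0; near=> y.
  have -> : (f \o shift x) y = 0.
    near: y; move: fx; rewrite (near_shift 0 x) => fx.
    by apply: filterS fx => y /=; rewrite subr0.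
  by rewrite normr0 mulr_ge0 // ltW.
have c0 : continuous (\0 : 'rV[R]_n -> R) by move=> y; exact: cst_continuous.
have dE := @diff_unique _ _ _ f \0 x c0 key.
by apply/diff_locallyP; rewrite dE; split.
Unshelve. all: by end_near. Qed.

Lemma differentiable_near f g x :
  (\near x, f x = g x) -> differentiable f x -> differentiable g x.
Proof.
move=> fg df; have -> : g = f + (g - f) by rewrite addrC subrK.
apply: differentiableD df _; apply: differentiable_near0.
apply: filterS fg => y fgy /=; rewrite -[LHS]/(g y - f y).
by rewrite fgy subrr.
Qed.

Lemma Ck_ext k U f g : open U -> (forall x, U x -> f x = g x) ->
  Ck k U f -> Ck k U g.
Proof.
elim: k f g => [|k IH] f g oU fg /=.
  move=> cf x Ux; rewrite /prop_for /continuous_at -(fg x Ux).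
  apply: cvg_trans (cf x Ux); apply: (@near_eq_cvg _ _ (nbhs x)).
  by apply: filterS (open_nbhs_nbhs (conj oU Ux)) => y Uy; exact: fg.
have N x : U x -> \near x, f x = g x.
  move=> Ux; apply: filterS (open_nbhs_nbhs (conj oU Ux)) => y Uy; exact: fg.
move=> [df cf]; split=> [x Ux|i].
  exact: differentiable_near (N x Ux) (df x Ux).
by apply: (IH _ _ oU _ (cf i)) => x Ux; exact: near_eq_derive (N x Ux).
Qed.

Lemma Ck_sub k U V f : V `<=` U -> Ck k U f -> Ck k V f.
Proof.
move=> VU; elim: k f => [|k IH] f /=; first by move=> + x /VU; exact.
by move=> [df cf]; split=> [x /VU/df|i] //; exact: IH.
Qed.

Lemma Ck_local k U f :
  (forall x, U x -> exists2 V, V x & Ck k V f) -> Ck k U f.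
Proof.
elim: k f => [|k IH] f /=; first by by move=> H x Ux; have [V Vx] := H x Ux; exact.
move=> H; split=> [x Ux|i]; first by have [V Vx []] := H x Ux => + _; exact.
by apply: IH => x /H[V Vx [_ c]]; exists V.
Qed.

Lemma CkS k U f : Ck k.+1 U f -> Ck k U f.
Proof.
elim: k f => [|k IH] f [df cf].
  by move=> x Ux; apply: differentiable_continuous; exact: df.
by split=> // i; apply: IH; exact: cf.
Qed.

Lemma Ck_cst k U (a : R) : Ck k U (cst a).
Proof.
elim: k a => [|k IH] a /=; first by move=> x _; exact: cst_continuous.
split=> [x _|i]; first exact: differentiable_cst.
have -> : 'D_(delta_mx 0 i) (cst a : 'rV[R]_n -> R) = cst 0.
  by rewrite funeqE => x; rewrite derive_cst.
exact: IH.
Qed.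

Lemma CkD k U f g : open U -> Ck k U f -> Ck k U g -> Ck k U (f + g).
Proof.
move=> oU; elim: k f g => [|k IH] f g /=.
  by move=> cf cg x Ux; exact: (cvgD (cf x Ux) (cg x Ux)).
move=> [df cf] [dg cg]; split=> [x Ux|i].
  by apply: differentiableD; [exact: df|exact: dg].
apply: Ck_ext (IH _ _ (cf i) (cg i)) => // x Ux.
by rewrite deriveD //; apply: diff_derivable; [exact: df|exact: dg].
Qed.

Lemma CkM k U f g : open U -> Ck k U f -> Ck k U g -> Ck k U (f * g).
Proof.
move=> oU; elim: k f g => [|k IH] f g.
  by move=> cf cg x Ux; exact: (cvgM (cf x Ux) (cg x Ux)).
move=> cf' cg'; have [[df cf] [dg cg]] := (cf', cg'); split=> [x Ux|i].
  by apply: differentiableM; [exact: df|exact: dg].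
apply: Ck_ext (CkD oU (IH _ _ (CkS cf') (cg i)) (IH _ _ (CkS cg') (cf i))) => //.
by move=> x Ux; rewrite deriveM //; apply: diff_derivable; [exact: df|exact: dg].
Qed.

End Euclidean.

Lemma Ck_sum (R : realType) n (I : finType) k (U : set 'rV[R]_n) (f : I -> 'rV[R]_n -> R) :
  open U -> (forall i, Ck k U (f i)) -> Ck k U (fun x => \sum_i f i x).
Proof.
move=> oU cf; have -> : (fun x => \sum_i f i x) = \sum_i f i.
  by rewrite funeqE => x; rewrite fct_sumE.
by elim/big_ind: _ => //; [exact: Ck_cst|move=> *; exact: CkD].
Qed.

Lemma Ck_comp (R : realType) n m k (U : set 'rV[R]_n) (V : set 'rV[R]_m)
    (f : 'rV[R]_n -> 'rV[R]_m) (g : 'rV[R]_m -> R) :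
  open U -> (forall x, U x -> V (f x)) ->
  (forall j, Ck k U (fun x => f x 0 j)) -> Ck k V g -> Ck k U (g \o f).
Proof.
move=> oU UV.
have fE : f = \sum_j (fun x => f x 0 j *: delta_mx 0 j).
  by rewrite funeqE => x; rewrite fct_sumE -row_sum_delta.
elim: k g => [|k IH] g.
  move=> cf cg x Ux; apply: (@continuous_comp _ _ _ f g); last exact: cg (UV _ Ux).
  rewrite fE; elim/big_ind: _ => [|a b ca cb|j _].
  - exact: cst_continuous.
  - exact: (cvgD ca cb).
  - exact: (cvgZ (cf j x Ux) (cvg_cst _)).
move=> cf [dg cg].
have df x : U x -> differentiable f x.
  move=> Ux; rewrite fE; apply: differentiable_sum => j.
  exact: (differentiableZl _ ((cf j).1 x Ux)).
split=> [x Ux|i].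
  by apply: differentiable_comp; [exact: df|exact: dg (UV _ Ux)].
have cf' j : Ck k U (fun x => f x 0 j) by exact: CkS (cf j).
apply: (@Ck_ext _ _ k U (fun x => \sum_j
   ('D_(delta_mx 0 i) (fun x => f x 0 j) * ('D_(delta_mx 0 j) g \o f)) x)) => //.
  move=> x Ux; rewrite deriveE; last first.
    by apply: differentiable_comp; [exact: df|exact: dg (UV _ Ux)].
  rewrite diff_comp /=; [|exact: df|exact: dg (UV _ Ux)].
  rewrite -(deriveE _ (df x Ux)) derive_mx; last exact/diff_derivable/df.
  rewrite [X in 'd g _ X]row_sum_delta linear_sum; apply: eq_bigr => j _.
  by rewrite linearZ /= mxE -deriveE //; exact: dg (UV _ Ux).
by apply: Ck_sum => // j; apply: CkM => //; [exact: (cf j).2 i|exact: (IH _ cf' (cg j))].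
Qed.

(* Only the values of cfwd on cdom and of cbwd on cfwd @` cdom are meaningful. *)
Record chart (R : realType) (T : topologicalType) (n : nat) := Chart {
  cdom : set T;
  cfwd : T -> 'rV[R]_n;
  cbwd : 'rV[R]_n -> T }.

(* The coordinate image c(cdom c `&` W). *)
Definition cimg R T n (c : @chart R T n) (W : set T) := cfwd c @` (cdom c `&` W).

Definition is_chart R T n (c : @chart R T n) : Prop :=
  [/\ open (cdom c), open (cfwd c @` cdom c),
      forall x, cdom c x -> cbwd c (cfwd c x) = x,
      {in cdom c, continuous (cfwd c)} &
      {in cfwd c @` cdom c, continuous (cbwd c)}].

(* Smooth manifolds are Hausdorff, second countable and of pure dimension. *)
Record manifold (R : realType) := Manifold {
  mcar :> topologicalType;
  mdim : nat;
  matlas : set (chart R mcar mdim);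
  m_hausdorff : hausdorff_space mcar;
  m_countable : @second_countable mcar;
  m_charts : forall c, matlas c -> is_chart c;
  m_cover : forall x : mcar, exists2 c, matlas c & cdom c x;
  m_compat : forall c c' j, matlas c -> matlas c' ->
    Cinf (cimg c (cdom c')) (fun y => cfwd c' (cbwd c y) 0 j) }.

Section SmoothFunctions.
Variables (R : realType) (M : manifold R).
Implicit Types (W : set M) (f g : M -> R).

(* f is C^oo on W, for W open; values of f outside of W are irrelevant. *)
Definition smooth_fun W f : Prop :=
  forall c, matlas c -> Cinf (cimg c W) (f \o cbwd c).

Lemma cimgP (c : chart R M (mdim M)) W y : matlas c ->
  cimg c W y <-> [/\ cdom c (cbwd c y), W (cbwd c y) & cfwd c (cbwd c y) = y].
Proof.
move=> /m_charts[_ _ K _ _]; split=> [[x [dx Wx] <-]|[dx Wx <-]].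
  by rewrite K.
by exists (cbwd c y).
Qed.

Lemma open_cimg c W : matlas c -> open W -> open (cimg c W).
Proof.
move=> ac oW; have [od oi K cf cb] := m_charts ac.
have -> : cimg c W = (cfwd c @` cdom c) `&` cbwd c @^-1` W.
  apply/seteqP; split=> y.
    by case=> x [dx Wx] <-; split=> /=; [exists x|rewrite K].
  by case=> -[x dx <-] /=; rewrite K // => Wx; exists x.
exact: ((continuous_inP _ oi).1 cb) W oW.
Qed.

Lemma smooth_sub W W' f : W' `<=` W -> smooth_fun W f -> smooth_fun W' f.
Proof.
move=> WW sf c ac k; apply: Ck_sub (sf c ac k).
by apply: image_subset => x [dx /WW].
Qed.

Lemma smooth_ext W f g : open W -> (forall x, W x -> f x = g x) ->
  smooth_fun W f -> smooth_fun W g.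
Proof.
move=> oW fg sf c ac k; apply: Ck_ext (sf c ac k); first exact: open_cimg.
by move=> y /(cimgP _ _ ac)[_ Wy _]; exact: fg.
Qed.

Lemma smooth_local W f :
  (forall x, W x -> exists2 V, V x & smooth_fun V f) -> smooth_fun W f.
Proof.
move=> H c ac k; apply: Ck_local => _ [x [dx Wx] <-].
have [V Vx sV] := H x Wx; exists (cimg c V); last exact: sV.
by exists x.
Qed.

Lemma smooth_cst W (a : R) : smooth_fun W (fun=> a).
Proof. by move=> c _ k; exact: Ck_cst. Qed.

Lemma smoothD W f g : open W -> smooth_fun W f -> smooth_fun W g ->
  smooth_fun W (fun x => f x + g x).
Proof.
move=> oW sf sg c ac k.
by apply: (@CkD _ _ _ _ (f \o cbwd c) (g \o cbwd c));
   [exact: open_cimg|exact: sf|exact: sg].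
Qed.

Lemma smoothM W f g : open W -> smooth_fun W f -> smooth_fun W g ->
  smooth_fun W (fun x => f x * g x).
Proof.
move=> oW sf sg c ac k.
by apply: (@CkM _ _ _ _ (f \o cbwd c) (g \o cbwd c));
   [exact: open_cimg|exact: sf|exact: sg].
Qed.

Lemma smooth_sum W (I : finType) (f : I -> M -> R) : open W ->
  (forall i, smooth_fun W (f i)) -> smooth_fun W (fun x => \sum_i f i x).
Proof.
move=> oW sf c ac k.
by apply: (@Ck_sum _ _ _ _ _ (fun i => f i \o cbwd c));
  [exact: open_cimg|move=> i; exact: sf].
Qed.

End SmoothFunctions.

Section SmoothMaps.
Variable R : realType.
Implicit Types M N P : manifold R.

Definition smooth_map M N (f : M -> N) : Prop :=
  continuous f /\
  forall c j, matlas c ->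
    smooth_fun (f @^-1` cdom c) (fun x => cfwd c (f x) 0 j).

Lemma open_preim M N (f : M -> N) W : smooth_map f -> open W -> open (f @^-1` W).
Proof. by move=> [/continuousP cf _]; exact: cf. Qed.

Lemma smooth_coord N (c : chart R N (mdim N)) j : matlas c ->
  smooth_fun (cdom c) (fun x => cfwd c x 0 j).
Proof. by move=> ac c' ac'; exact: m_compat. Qed.

Lemma smooth_pull M N (f : M -> N) W g : smooth_map f -> open W ->
  smooth_fun W g -> smooth_fun (f @^-1` W) (g \o f).
Proof.
move=> sf oW sg c ac k; apply: Ck_local => y /(cimgP _ _ ac)[dy Wy yE].
have [c' ac' dc'] := m_cover (f (cbwd c y)).
have [od' _ K' _ _] := m_charts ac'.
exists (cimg c (f @^-1` (cdom c' `&` W))); first by apply/cimgP.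
have oI : open (cimg c (f @^-1` (cdom c' `&` W))).
  by apply: open_cimg => //; apply: open_preim => //; exact: openI.
apply: (@Ck_ext _ _ _ _ ((g \o cbwd c') \o (fun z => cfwd c' (f (cbwd c z))))).
- by [].
- by move=> z /(cimgP _ _ ac)[_ [d' _] _] /=; rewrite K'.
apply: (Ck_comp oI _ _ (sg c' ac' k)).
- move=> z /(cimgP _ _ ac)[_ [d' W'] _]; exists (f (cbwd c z)) => //.
- move=> j; have := sf.2 c' j ac' c ac k; apply: Ck_sub.
  by apply: image_subset => x [dx []].
Qed.

Lemma smooth_map_id M : smooth_map (@id M).
Proof. by split=> [x|c j ac]; [exact: cvg_id|exact: smooth_coord]. Qed.

Lemma smooth_map_comp M N P (f : M -> N) (g : N -> P) :
  smooth_map f -> smooth_map g -> smooth_map (g \o f).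
Proof.
move=> sf sg; split=> [x|c j ac].
  by apply: continuous_comp; [exact: sf.1|exact: sg.1].
apply: (smooth_pull sf _ (sg.2 c j ac)); apply: open_preim => //.
by have [] := m_charts ac.
Qed.

End SmoothMaps.

Section Forms.
Variables (R : realType) (V : lmodType R).
Implicit Types (w a b c : seq V -> R) (s t : seq V).

(* Elements of /\^. V^* are encoded as functions w : seq V -> R, whose
   restriction to sequences of length l is the component in /\^l V^*, an
   alternating l-linear form on V. When dim V = r, w vanishes on sequences of
   length > r (alternating_vanish), so the direct sum over l is the product. *)
Definition alternating w : Prop :=
  (forall s t (k : R) u v,
     w (s ++ (k *: u + v) :: t) = k * w (s ++ u :: t) + w (s ++ v :: t)) /\
  (forall s1 s2 s3 u, w (s1 ++ u :: s2 ++ u :: s3) = 0).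

(* The signed shuffle product
     (a /\ b)(v_1..v_n) = \sum_S sgn(S, ~S) a(v_S) b(v_~S),
   S ranging over the subsets of {1..n}, computed by splitting on 1 \in S:
   contraction by v is an antiderivation,
     i_v (a /\ b) = (i_v a) /\ b + (-1)^|a| a /\ (i_v b). *)
Fixpoint wedge a b s : R :=
  if s is v :: t then
    wedge (fun r => a (v :: r)) b t +
    wedge (fun r => (-1) ^+ size r * a r) (fun r => b (v :: r)) t
  else a [::] * b [::].

Definition form1 : seq V -> R := fun s => (s == [::])%:R.

Definition form_deg (k : nat) w : Prop := forall s, size s != k -> w s = 0.

Definition contr v w : seq V -> R := fun r => w (v :: r).
Definition gsgn w : seq V -> R := fun r => (-1) ^+ size r * w r.

Lemma wedge_cons a b v s : wedge a b (v :: s) =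
  wedge (contr v a) b s + wedge (gsgn a) (contr v b) s.
Proof. by []. Qed.

Lemma wedgeDl a b c s (k : R) :
  wedge (fun r => k * a r + b r) c s = k * wedge a c s + wedge b c s.
Proof.
elim: s a b c => [|v s IH] a b c /=; first by ring.
rewrite IH; have -> : (fun r => (-1) ^+ size r * (k * a r + b r)) =
  (fun r => k * ((-1) ^+ size r * a r) + (-1) ^+ size r * b r).
  by apply/funext => r; ring.
by rewrite IH; ring.
Qed.

Lemma wedgeDr a b c s (k : R) :
  wedge a (fun r => k * b r + c r) s = k * wedge a b s + wedge a c s.
Proof.
elim: s a b c => [|v s IH] a b c /=; first by ring.
by rewrite !IH; ring.
Qed.

Lemma wedge0l b s : wedge (fun=> 0) b s = 0.
Proof.
elim: s b => [|v s IH] b /=; first by rewrite mul0r.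
have -> : (fun r : seq V => (-1) ^+ size r * 0) = (fun=> 0 : R).
  by apply/funext => r; rewrite mulr0.
by rewrite !IH addr0.
Qed.

Lemma wedge0r a s : wedge a (fun=> 0) s = 0.
Proof.
by elim: s a => [|v s IH] a /=; [rewrite mulr0|rewrite !IH addr0].
Qed.

Lemma wedgeZl a c s (k : R) : wedge (fun r => k * a r) c s = k * wedge a c s.
Proof.
rewrite -[RHS]addr0 -(wedge0l c s) -wedgeDl; congr (wedge _ c s).
by apply/funext => r; rewrite addr0.
Qed.

Lemma wedgeZr a c s (k : R) : wedge a (fun r => k * c r) s = k * wedge a c s.
Proof.
rewrite -[RHS]addr0 -(wedge0r a s) -wedgeDr; congr (wedge a _ s).
by apply/funext => r; rewrite addr0.
Qed.

Lemma wedge1l a s : wedge form1 a s = a s.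
Proof.
elim: s a => [|v s IH] a; first by rewrite /= /form1 eqxx mul1r.
rewrite wedge_cons.
have -> : contr v form1 = fun=> 0 by apply/funext => r.
have -> : gsgn form1 = form1.
  by apply/funext => -[|u r]; rewrite /gsgn /form1 /= ?mulr0 // mul1r.
by rewrite wedge0l add0r IH.
Qed.

Lemma wedge1r a s : wedge a form1 s = a s.
Proof.
elim: s a => [|v s IH] a; first by rewrite /= /form1 eqxx mulr1.
rewrite wedge_cons.
have -> : contr v form1 = fun=> 0 by apply/funext => r.
by rewrite wedge0r addr0 IH.
Qed.

Lemma gsgn_wedge a b s : gsgn (wedge a b) s = wedge (gsgn a) (gsgn b) s.
Proof.
elim: s a b => [|v s IH] a b; first by rewrite /gsgn /= !expr0 !mul1r.
rewrite /gsgn [size _]/= wedge_cons exprS mulrDr -!mulrA -!/(gsgn _ s) !IH.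
rewrite wedge_cons mulN1r mulN1r; congr (_ + _).
  have -> : contr v (gsgn a) = fun r => (-1) * gsgn (contr v a) r.
    by apply/funext => r; rewrite /contr /gsgn /= exprS mulrA.
  by rewrite wedgeZl mulN1r.
have -> : contr v (gsgn b) = fun r => (-1) * gsgn (contr v b) r.
  by apply/funext => r; rewrite /contr /gsgn /= exprS mulrA.
by rewrite wedgeZr mulN1r.
Qed.

Lemma wedgeA a b c s : wedge a (wedge b c) s = wedge (wedge a b) c s.
Proof.
elim: s a b c => [|v s IH] a b c; first by rewrite /= mulrA.
rewrite !wedge_cons.
have -> : contr v (wedge b c) = fun r => 1 * wedge (contr v b) c r + wedge (gsgn b) (contr v c) r.
  by apply/funext => r; rewrite /contr wedge_cons mul1r.
have -> : contr v (wedge a b) = fun r => 1 * wedge (contr v a) b r + wedge (gsgn a) (contr v b) r.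
  by apply/funext => r; rewrite /contr wedge_cons mul1r.
have -> : gsgn (wedge a b) = wedge (gsgn a) (gsgn b) by apply/funext => r; exact: gsgn_wedge.
by rewrite wedgeDl wedgeDr !mul1r !IH addrA.
Qed.

Lemma form_degM j k a b :
  form_deg j a -> form_deg k b -> form_deg (j + k) (wedge a b).
Proof.
move=> + + s; elim: s j k a b => [|v s IH] j k a b da db /=.
  rewrite eq_sym addn_eq0 negb_and => /orP[j0|k0].
    by rewrite da ?mul0r // eq_sym.
  by rewrite db ?mulr0 // eq_sym.
move=> ss.
have -> : wedge (fun r => a (v :: r)) b s = 0.
  case: j da ss => [|j] da ss.
    have -> : (fun r => a (v :: r)) = fun=> 0 by apply/funext => r; exact: da.
    exact: wedge0l.
  by apply: (IH j k) => // r rj; apply: da.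
rewrite add0r; case: k db ss => [|k] db ss.
  have -> : (fun r => b (v :: r)) = fun=> 0 by apply/funext => r; exact: db.
  exact: wedge0r.
apply: (IH j k); last by move: ss; rewrite addnS.
  by move=> r rj; rewrite da ?mulr0.
by move=> r rj; apply: db.
Qed.

Lemma gsgn_deg k a : form_deg k a -> gsgn a = fun r => (-1) ^+ k * a r.
Proof.
move=> da; apply/funext => r; rewrite /gsgn.
by have [->//|nk] := eqVneq (size r) k; rewrite da ?mulr0.
Qed.

Lemma wedge_comm j k a b s : form_deg j a -> form_deg k b ->
  wedge a b s = (-1) ^+ (j * k) * wedge b a s.
Proof.
elim: s j k a b => [|v s IH] j k a b da db.
  rewrite /= mulrC; have [->|j0] := eqVneq j 0%N; first by rewrite mul0n mul1r.
  by rewrite da ?mulr0 // eq_sym.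
rewrite !wedge_cons (gsgn_deg da) (gsgn_deg db) !wedgeZl mulrDr addrC.
have Hi l w : form_deg l w -> (l = 0%N /\ contr v w = fun=> 0) \/
    (exists2 l', l = l'.+1 & form_deg l' (contr v w)).
  case: l => [|l] dw; first by left; split=> //; apply/funext => r; exact: dw.
  by right; exists l => // r rl; apply: dw.
congr (_ + _).
  have [[k0 ->]|[k' k'E db']] := Hi _ _ db; first by rewrite wedge0r wedge0l !mulr0.
  rewrite (IH _ _ _ _ da db') mulrA k'E mulnS exprD; congr (_ * _).
have [[j0 ->]|[j' j'E da']] := Hi _ _ da; first by rewrite wedge0r wedge0l !mulr0.
rewrite (IH _ _ _ _ da' db) [RHS]mulrA j'E mulSn exprD; congr (_ * _).
by rewrite mulrAC -expr2 sqrr_sign mul1r.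
Qed.

Lemma alternating_adj w :
  (forall s t (k : R) u v,
     w (s ++ (k *: u + v) :: t) = k * w (s ++ u :: t) + w (s ++ v :: t)) ->
  (forall s t u, w (s ++ u :: u :: t) = 0) -> alternating w.
Proof.
move=> lw aw; split=> // s1 s2; elim: s2 s1 => [|v s2 IH] s1 s3 u /=.
  exact: aw.
have wD s t u1 u2 : w (s ++ (u1 + u2) :: t) = w (s ++ u1 :: t) + w (s ++ u2 :: t).
  by rewrite -[in LHS](scale1r u1) lw mul1r.
have := aw s1 (s2 ++ u :: s3) (u + v).
have E x := wD (rcons s1 x) (s2 ++ u :: s3) u v.
rewrite wD; move: (E u) (E v); rewrite !cat_rcons => -> ->; rewrite !aw add0r addr0.
by rewrite -(cat_rcons v s1) IH addr0.
Qed.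

Lemma wedge_lin a b s t (k : R) u v : alternating a -> alternating b ->
  wedge a b (s ++ (k *: u + v) :: t) =
    k * wedge a b (s ++ u :: t) + wedge a b (s ++ v :: t).
Proof.
move=> [la _] [lb _]; elim: s a b la lb => [|x s IH] a b la lb.
  rewrite !cat0s !wedge_cons.
  have -> : contr (k *: u + v) a = fun r => k * contr u a r + contr v a r.
    by apply/funext => r; exact: (la [::]).
  have -> : contr (k *: u + v) b = fun r => k * contr u b r + contr v b r.
    by apply/funext => r; exact: (lb [::]).
  by rewrite wedgeDl wedgeDr; ring.
rewrite !cat_cons !wedge_cons !IH.
- by ring.
- by move=> s' t' l p q; rewrite /gsgn la !size_cat /=; ring.
- by move=> s' t' l p q; rewrite /contr -!cat_cons lb.
- by move=> s' t' l p q; rewrite /contr -!cat_cons la.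
- by [].
Qed.

Lemma wedge_alt a b : alternating a -> alternating b -> alternating (wedge a b).
Proof.
move=> A B; apply: alternating_adj => [s t k u v|s t u]; first exact: wedge_lin.
move: A B => [la aa] [lb ab].
have {}aa s1 s2 v : a (s1 ++ v :: v :: s2) = 0 by exact: (aa s1 [::]).
have {}ab s1 s2 v : b (s1 ++ v :: v :: s2) = 0 by exact: (ab s1 [::]).
elim: s a b {la lb} aa ab => [|x s IH] a b aa ab.
  rewrite cat0s !wedge_cons.
  have -> : contr u (contr u a) = fun=> 0 by apply/funext => r; exact: (aa [::]).
  have -> : contr u (contr u b) = fun=> 0 by apply/funext => r; exact: (ab [::]).
  have -> : contr u (gsgn a) = fun r => (-1) * gsgn (contr u a) r.
    by apply/funext => r; rewrite /contr /gsgn /= exprS mulrA.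
  by rewrite wedge0l wedge0r wedgeZl; ring.
rewrite cat_cons wedge_cons !IH ?addr0 //.
- by move=> s1 s2 v; rewrite /gsgn aa mulr0.
- by move=> s1 s2 v; rewrite /contr -cat_cons ab.
- by move=> s1 s2 v; rewrite /contr -cat_cons aa.
Qed.

Lemma alternating0 : alternating (fun=> 0).
Proof. by split=> // s t k u v; rewrite mulr0 addr0. Qed.

Lemma alternating_lin (k : R) a b : alternating a -> alternating b ->
  alternating (fun s => k * a s + b s).
Proof.
move=> [la aa] [lb ab]; split=> [s t l u v|s1 s2 s3 u].
  by rewrite la lb; ring.
by rewrite aa ab mulr0 addr0.
Qed.

Lemma alternating1 : alternating form1.
Proof.
by split=> [[|? ?] t k u v|[|? ?] s2 s3 u] //; rewrite /form1 /= mulr0 addr0.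
Qed.

Lemma alternating_part w k : alternating w ->
  alternating (fun s => (size s == k)%:R * w s).
Proof.
move=> [lw aw]; split=> [s t l u v|s1 s2 s3 u].
  by rewrite lw !size_cat /=; ring.
by rewrite aw mulr0.
Qed.

End Forms.

Section Pullback.
Variables (R : realType) (V W : lmodType R) (L : V -> W).

Lemma wedge_map a b s :
  wedge a b [seq L v | v <- s] =
  wedge (fun r => a [seq L v | v <- r]) (fun r => b [seq L v | v <- r]) s.
Proof.
elim: s a b => [|v s IH] a b //=; rewrite !IH; congr (_ + wedge _ _ s).
by apply/funext => r; rewrite size_map.
Qed.

Lemma alternating_map w : linear L -> alternating w ->
  alternating (fun s => w [seq L v | v <- s]).
Proof.
move=> lL [lw aw]; split=> [s t k u v|s1 s2 s3 u].
  by rewrite !map_cat /= lL lw.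
by rewrite !map_cat /= map_cat /= aw.
Qed.

End Pullback.

(* N-graded graded-commutative unital associative R-algebras. The zero algebra
   is allowed (it is the value of a sheaf on the empty set), which excludes
   algType. gdeg n is the homogeneous component of degree n; gdeg_span and
   gdeg_free say that the algebra is the direct sum of its components. *)
Record gcalg (R : realType) := GCAlg {
  gcar :> lmodType R;
  gone : gcar;
  gmul : gcar -> gcar -> gcar;
  gdeg : nat -> set gcar;
  gmulA : associative gmul;
  gmul1l : left_id gone gmul;
  gmul1r : right_id gone gmul;
  gmul_linl : forall (k : R) a b c,
    gmul (k *: a + b) c = k *: gmul a c + gmul b c;
  gmul_linr : forall (k : R) a b c,
    gmul a (k *: b + c) = k *: gmul a b + gmul a c;
  gdeg0 : forall n, gdeg n 0;
  gdeg_lin : forall n (k : R) a b, gdeg n a -> gdeg n b -> gdeg n (k *: a + b);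
  gdeg_one : gdeg 0 gone;
  gdegM : forall m n a b, gdeg m a -> gdeg n b -> gdeg (m + n)%N (gmul a b);
  gdeg_span : forall a, exists n (c : nat -> gcar),
    (forall k, gdeg k (c k)) /\ a = \sum_(k < n) c k;
  gdeg_free : forall n (c : nat -> gcar), (forall k, gdeg k (c k)) ->
    \sum_(k < n) c k = 0 -> forall k, (k < n)%N -> c k = 0;
  gcomm : forall m n a b, gdeg m a -> gdeg n b ->
    gmul a b = (-1) ^+ (m * n) *: gmul b a }.

Definition gmorph (R : realType) (A B : gcalg R) (f : A -> B) : Prop :=
  [/\ linear f, f (gone A) = gone B,
      forall a b, f (gmul a b) = gmul (f a) (f b) &
      forall n a, gdeg n a -> gdeg n (f a)].

(* Sheaves of graded-commutative algebras. gsec and gres are total functions on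
   sets for convenience: sections over a non-open set are junk values, to which
   no axiom and no morphism of sheaves refers. *)
Record gsheaf (R : realType) (T : topologicalType) := GSheaf {
  gsec : set T -> gcalg R;
  gres : forall U V, V `<=` U -> gsec U -> gsec V;
  gres_morph : forall U V (VU : V `<=` U), open U -> open V -> gmorph (gres VU);
  gres_id : forall U (UU : U `<=` U) s, open U -> gres UU s = s;
  gres_comp : forall U V W (VU : V `<=` U) (WV : W `<=` V) (WU : W `<=` U) s,
    open U -> open V -> open W -> gres WV (gres VU s) = gres WU s;
  gglue : forall (U : set T) (I : Type) (V : I -> set T)
    (VU : forall i, V i `<=` U) (s : forall i, gsec (V i)),
    (forall i, open (V i)) -> U = \bigcup_i V i ->
    (forall i j, gres (@subIsetl _ (V i) (V j)) (s i) =
                 gres (@subIsetr _ (V i) (V j)) (s j)) ->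
    exists! x : gsec U, forall i, gres (VU i) x = s i }.

(* The restrictions of C and D to the open set U are isomorphic sheaves of graded
   algebras. The maps th V with V open and included in U form the isomorphism,
   the other ones are junk. *)
Definition sheaf_iso_on (R : realType) (T : topologicalType)
    (U : set T) (C D : gsheaf R T) : Prop :=
  exists th : forall V, gsec C V -> gsec D V,
    (forall V, open V -> V `<=` U -> gmorph (@th V) /\ bijective (@th V)) /\
    (forall V W (WV : W `<=` V), open V -> open W -> V `<=` U ->
       forall s, th W (gres WV s) = gres WV (th V s)).

(* A local trivialisation of E over tdom: for x in tdom, tfwd x : E x -> R^r is a
   linear isomorphism with inverse tbwd x; other values are junk. *)
Record triv (R : realType) (M : manifold R) (E : M -> lmodType R) (r : nat) :=
  Triv {
    tdom : set M;
    tfwd : forall x, E x -> 'rV[R]_r;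
    tbwd : forall x, 'rV[R]_r -> E x }.

Definition tframe R M E r (t : @triv R M E r) (x : M) (i : 'I_r) : E x :=
  tbwd t x (delta_mx 0 i).

(* A smooth vector bundle of rank vrank over vbase, given by its fibres and an
   atlas of local trivialisations whose transition matrices are smooth. The total
   space {x : vbase & vfib x} has a unique structure of manifold for which these
   trivialisations are diffeomorphisms tdom x R^vrank. *)
Record vbundle (R : realType) := VBundle {
  vbase : manifold R;
  vrank : nat;
  vfib : vbase -> lmodType R;
  vtrivs : set (triv vfib vrank);
  v_open : forall t, vtrivs t -> open (tdom t);
  v_cover : forall x, exists2 t, vtrivs t & tdom t x;
  v_lin : forall t x, vtrivs t -> tdom t x -> linear (@tfwd _ _ _ _ t x);
  v_fwdK : forall t x, vtrivs t -> tdom t x -> cancel (@tfwd _ _ _ _ t x) (tbwd t x);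
  v_bwdK : forall t x, vtrivs t -> tdom t x -> cancel (tbwd t x) (@tfwd _ _ _ _ t x);
  v_trans : forall t t' i j, vtrivs t -> vtrivs t' ->
    smooth_fun (tdom t `&` tdom t') (fun x => tfwd t' (tframe t x i) 0 j) }.

Section TrivialBundle.
Variables (R : realType) (M : manifold R) (m : nat).

Definition trivial_fib (_ : M) : lmodType R := 'rV[R]_m.
Definition trivial_triv : triv trivial_fib m := Triv setT (fun _ => id) (fun _ => id).

Fact trivial_open t : [set trivial_triv] t -> open (tdom t).
Proof. by move=> ->; exact: openT. Qed.

Fact trivial_cover x : exists2 t, [set trivial_triv] t & tdom t x.
Proof. by exists trivial_triv. Qed.

Fact trivial_lin t x : [set trivial_triv] t -> tdom t x ->
  linear (@tfwd _ _ _ _ t x).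
Proof. by move=> -> _ k u v. Qed.

Fact trivial_fwdK t x : [set trivial_triv] t -> tdom t x ->
  cancel (@tfwd _ _ _ _ t x) (tbwd t x).
Proof. by move=> -> _. Qed.

Fact trivial_bwdK t x : [set trivial_triv] t -> tdom t x ->
  cancel (tbwd t x) (@tfwd _ _ _ _ t x).
Proof. by move=> -> _. Qed.

Fact trivial_trans t t' i j : [set trivial_triv] t -> [set trivial_triv] t' ->
  smooth_fun (tdom t `&` tdom t') (fun x => tfwd t' (tframe t x i) 0 j).
Proof. by move=> -> ->; exact: smooth_cst. Qed.

Definition trivial_vbundle : vbundle R :=
  VBundle trivial_open trivial_cover trivial_lin trivial_fwdK trivial_bwdK
    trivial_trans.

End TrivialBundle.

Section FormsFrame.
Variables (R : realType) (V : lmodType R) (w : seq V -> R).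
Hypothesis aw : alternating w.

Lemma alternating_sum (r : nat) (c : 'I_r -> R) (e : 'I_r -> V) s t :
  w (s ++ (\sum_i c i *: e i) :: t) = \sum_i c i * w (s ++ e i :: t).
Proof.
have [lw _] := aw.
have w0 : w (s ++ 0 :: t) = 0.
  have := lw s t 1 0 0; rewrite scaler0 addr0 mul1r => /eqP.
  by rewrite -subr_eq subrr eq_sym => /eqP.
elim: (index_enum _) => [|i l IH]; first by rewrite !big_nil.
by rewrite !big_cons lw IH.
Qed.

Lemma alternating_vanish (r : nat) (e : 'I_r -> V) :
  (forall v, exists c : 'I_r -> R, v = \sum_i c i *: e i) ->
  forall s, (r < size s)%N -> w s = 0.
Proof.
move=> spe s rs.
suff H t (I : seq 'I_r) : (r < size I + size t)%N -> w (map e I ++ t) = 0.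
  exact: (H s [::]).
elim: t I => [|v t IH] I.
  rewrite addn0 => rI; have : ~~ uniq I.
    apply: contraL rI => /card_uniqP uI; rewrite -leqNgt -uI.
    by rewrite -[leqRHS]card_ord max_card.
  rewrite cats0 => nu.
  suff [I1 [I2 [I3 [i ->]]]] : exists I1 I2 I3 i, I = I1 ++ i :: I2 ++ i :: I3.
    by rewrite !map_cat /= map_cat /= aw.2.
  elim: I nu {rI} => [//|i I IHI] /=; rewrite negb_and negbK => /orP[iI|/IHI].
    by case/splitPr: iI => p1 p2; exists [::], p1, p2, i.
  by move=> [I1 [I2 [I3 [j ->]]]]; exists (i :: I1), I2, I3, j.
move=> rI; have [c ->] := spe v; rewrite alternating_sum big1 // => i _.
rewrite -cat_rcons -map_rcons IH ?mulr0 // size_rcons.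
by move: rI => /=; rewrite addnS.
Qed.

End FormsFrame.

Lemma smooth_expand (R : realType) (M : manifold R) (E : M -> lmodType R)
  (W : set M) r (e : forall x, 'I_r -> E x) (w : forall x, seq (E x) -> R)
  (J : Type) (v : J -> forall x, E x) (c : J -> 'I_r -> M -> R) :
  open W -> (forall x, alternating (w x)) ->
  (forall I, smooth_fun W (fun x => w x (map (e x) I))) ->
  (forall k i, smooth_fun W (c k i)) ->
  (forall k x, W x -> v k x = \sum_i c k i x *: e x i) ->
  forall K, smooth_fun W (fun x => w x (map (fun k => v k x) K)).
Proof.
move=> oW aw sw sc vE K.
suff H I : smooth_fun W (fun x => w x (map (e x) I ++ map (fun k => v k x) K)).
  exact: (H [::]).
elim: K I => [|k K IH] I.
  by apply: smooth_ext (sw I) => // x _; rewrite cats0.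
apply: (@smooth_ext _ _ _ (fun x => \sum_i c k i x *
   w x (map (e x) (rcons I i) ++ map (fun k => v k x) K))) => //.
  move=> x Wx /=; rewrite (vE k x Wx) alternating_sum //; apply: eq_bigr => i _.
  by rewrite map_rcons cat_rcons.
by apply: smooth_sum => // i; apply: smoothM => //; exact: IH.
Qed.

Section Sections.
Variables (R : realType) (E : vbundle R).
Local Notation M := (vbase E).
Implicit Types (W : set M).

(* Smooth sections over W of /\^. E^*, extended by 0 outside of W so that they are
   determined by their values on W. Smooth means that the components of w in the
   local frames of /\^. E^* given by the trivialisations of E are smooth. For W
   open, W^° is W; the interior makes sections over any set a vector space. *)
Definition is_section W (w : forall x, seq (vfib x) -> R) : Prop :=
  [/\ forall x, alternating (w x),
      forall x s, ~ W x -> w x s = 0 &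
      forall (t : triv (@vfib _ E) (vrank E)) I, vtrivs t ->
        smooth_fun (W^° `&` tdom t) (fun x => w x [seq tframe t x i | i <- I])].

Record section W := Section {
  sfun :> forall x, seq (@vfib _ E x) -> R;
  sfunP : is_section W sfun }.

Lemma section_ext W (a b : section W) : (forall x s, a x s = b x s) -> a = b.
Proof.
case: a b => [a Pa] [b Pb] /= ab.
have {}ab : a = b by apply: functional_extensionality_dep => x; apply/funext.
by case: b / ab Pb => Pb; congr Section; exact: Prop_irrelevance.
Qed.

Lemma open_secdom W t : vtrivs t -> open (W^° `&` tdom t).
Proof. by move=> vt; apply: openI; [exact: open_interior|exact: v_open]. Qed.

Fact section_lin_subproof W (k : R) (a b : section W) :
  is_section W (fun x s => k * a x s + b x s).
Proof.
have [aa za sa] := sfunP a; have [ab zb sb] := sfunP b; split.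
- by move=> x; exact: alternating_lin.
- by move=> x s Wx; rewrite za // zb // mulr0 addr0.
- move=> t I vt; have oW := open_secdom W vt.
  by apply: smoothD => //; [apply: smoothM => //; [exact: smooth_cst|exact: sa]|exact: sb].
Qed.
Definition section_lin W k a b : section W := Section (section_lin_subproof k a b).

Fact section0_subproof W : is_section W (fun _ _ => 0).
Proof.
split=> // [x|t I vt]; [exact: alternating0|exact: smooth_cst].
Qed.
Definition section0 W : section W := Section (section0_subproof W).

HB.instance Definition _ W := gen_eqMixin (section W).
HB.instance Definition _ W := gen_choiceMixin (section W).

Section Zmod.
Variable W : set M.
Implicit Types a b c : section W.
Definition section_add a b : section W := section_lin 1 a b.
Definition section_opp a : section W := section_lin (-1) a (section0 W).
Definition section_scale (k : R) a : section W := section_lin k a (section0 W).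
Fact section_addA : associative section_add.
Proof. by move=> a b c; apply: section_ext => x s /=; ring. Qed.
Fact section_addC : commutative section_add.
Proof. by move=> a b; apply: section_ext => x s /=; ring. Qed.
Fact section_add0 : left_id (section0 W) section_add.
Proof. by move=> a; apply: section_ext => x s /=; ring. Qed.
Fact section_addN : left_inverse (section0 W) section_opp section_add.
Proof. by move=> a; apply: section_ext => x s /=; ring. Qed.
HB.instance Definition _ := GRing.isZmodule.Build (section W)
  section_addA section_addC section_add0 section_addN.

Fact section_scaleA k l a : section_scale k (section_scale l a) = section_scale (k * l) a.
Proof. by apply: section_ext => x s /=; ring. Qed.
Fact section_scale1 : left_id 1 section_scale.
Proof. by move=> a; apply: section_ext => x s /=; ring. Qed.
Fact section_scaleDr : right_distributive section_scale +%R.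
Proof. by move=> k a b; apply: section_ext => x s /=; ring. Qed.
Fact section_scaleDl a : {morph section_scale^~ a : k l / k + l}.
Proof. by move=> k l; apply: section_ext => x s /=; ring. Qed.
HB.instance Definition _ := GRing.Zmodule_isLmodule.Build R (section W)
  section_scaleA section_scale1 section_scaleDr section_scaleDl.

Lemma section_linE k a b x s : (k *: a + b) x s = k * a x s + b x s.
Proof. by rewrite /= mul1r addr0. Qed.
Lemma section_scaleE k a x s : (k *: a) x s = k * a x s.
Proof. by rewrite /= addr0. Qed.
Lemma section_addE a b x s : (a + b) x s = a x s + b x s.
Proof. by rewrite /= mul1r. Qed.
Lemma section_sumE n (c : nat -> section W) x s :
  (\sum_(k < n) c k) x s = \sum_(k < n) c k x s.
Proof.
elim: n => [|n IH]; first by rewrite !big_ord0.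
by rewrite !big_ord_recr section_addE IH.
Qed.

Fact section_one_subproof :
  is_section W (fun x s => if `[< W x >] then form1 s else 0).
Proof.
split.
- by move=> x; case: asboolP => _; [exact: alternating1|exact: alternating0].
- by move=> x s Wx; case: asboolP.
- move=> t I vt; have oW := open_secdom W vt.
  apply: (@smooth_ext _ _ _ (fun=> (I == [::])%:R)) => //; last exact: smooth_cst.
  move=> x [/interior_subset Wx _]; case: asboolP => // _.
  by rewrite /form1; case: I.
Qed.
Definition section_one : section W := Section section_one_subproof.

Lemma smooth_wedge (O : set M) (J : Type) (e : forall x : M, J -> vfib x)
    (a b : forall x : M, seq (vfib x) -> R) : open O ->
  (forall I, smooth_fun O (fun x => a x (map (e x) I))) ->
  (forall I, smooth_fun O (fun x => b x (map (e x) I))) ->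
  forall I, smooth_fun O (fun x => wedge (a x) (b x) (map (e x) I)).
Proof.
move=> oO + + I; elim: I a b => [|i I IH] a b sa sb /=.
  by apply: smoothM => //; [exact: (sa [::])|exact: (sb [::])].
apply: smoothD => //.
  by apply: (IH (fun x r => a x (e x i :: r))) => // I'; exact: (sa (i :: I')).
apply: (IH (fun x r => (-1) ^+ size r * a x r) (fun x r => b x (e x i :: r))).
  move=> I'; apply: (@smooth_ext _ _ _ (fun x => (-1) ^+ size I' * a x (map (e x) I'))).
  - by [].
  - by move=> x _; rewrite size_map.
  - by apply: smoothM => //; exact: smooth_cst.
by move=> I'; exact: (sb (i :: I')).
Qed.

Fact section_mul_subproof a b : is_section W (fun x => wedge (a x) (b x)).
Proof.
have [aa za sa] := sfunP a; have [ab zb sb] := sfunP b; split.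
- by move=> x; exact: wedge_alt.
- move=> x s Wx; have -> : a x = fun=> 0 by apply/funext => r; exact: za.
  exact: wedge0l.
- move=> t I vt; apply: smooth_wedge => [|I'|I'].
  + exact: open_secdom.
  + exact: sa.
  + exact: sb.
Qed.
Definition section_mul a b : section W := Section (section_mul_subproof a b).

Definition section_deg (n : nat) : set (section W) :=
  [set a | forall x, form_deg n (a x)].

Lemma fib_span (x : M) : exists e : 'I_(vrank E) -> vfib x,
  forall v, exists c : 'I_(vrank E) -> R, v = \sum_i c i *: e i.
Proof.
have [t vt tx] := v_cover x; exists (tframe t x) => v.
exists (fun i => tfwd t v 0 i).
apply: (can_inj (v_fwdK vt tx)).
have lt := v_lin vt tx.
pose L := GRing.isLinear.Build _ _ _ _ _ lt.
pose f : {linear _ -> _} := HB.pack (@tfwd _ _ _ _ t x) L.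
rewrite -[RHS]/(f _) linear_sum [LHS]row_sum_delta; apply: eq_bigr => i _.
by rewrite linearZ /= (v_bwdK vt tx).
Qed.

Fact section_part_subproof a k :
  is_section W (fun x s => (size s == k)%:R * a x s).
Proof.
have [aa za sa] := sfunP a; split.
- by move=> x; exact: alternating_part.
- by move=> x s Wx; rewrite za // mulr0.
- move=> t I vt; have oW := open_secdom W vt.
  apply: (@smooth_ext _ _ _ (fun x => (size I == k)%:R * a x (map (tframe t x) I))).
  + by [].
  + by move=> x _; rewrite size_map.
  + by apply: smoothM => //; [exact: smooth_cst|exact: sa].
Qed.

Fact section_mulA : associative section_mul.
Proof. by move=> a b c; apply: section_ext => x s; exact: wedgeA. Qed.

Fact section_mul1l : left_id section_one section_mul.
Proof.
move=> a; apply: section_ext => x s /=; have [_ za _] := sfunP a.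
by case: asboolP => Wx; [exact: wedge1l|rewrite wedge0l za].
Qed.

Fact section_mul1r : right_id section_one section_mul.
Proof.
move=> a; apply: section_ext => x s /=; have [_ za _] := sfunP a.
by case: asboolP => Wx; [exact: wedge1r|rewrite wedge0r za].
Qed.

Fact section_mul_linl k a b c :
  section_mul (k *: a + b) c = k *: section_mul a c + section_mul b c.
Proof.
apply: section_ext => x s; rewrite section_linE -wedgeDl.
by congr (wedge _ _ s); apply/funext => r; exact: section_linE.
Qed.

Fact section_mul_linr k a b c :
  section_mul a (k *: b + c) = k *: section_mul a b + section_mul a c.
Proof.
apply: section_ext => x s; rewrite section_linE -wedgeDr.
by congr (wedge _ _ s); apply/funext => r; exact: section_linE.
Qed.

Fact section_deg0 n : section_deg n 0.
Proof. by move=> x s. Qed.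

Fact section_deg_lin n k a b :
  section_deg n a -> section_deg n b -> section_deg n (k *: a + b).
Proof.
by move=> da db x s sn; rewrite section_linE da // db // mulr0 addr0.
Qed.

Fact section_deg_one : section_deg 0 section_one.
Proof. by move=> x [|v s] //= _; case: asboolP. Qed.

Fact section_degM m n a b :
  section_deg m a -> section_deg n b -> section_deg (m + n)%N (section_mul a b).
Proof. by move=> da db x; exact: form_degM. Qed.

Fact section_deg_span a : exists n (c : nat -> section W),
  (forall k, section_deg k (c k)) /\ a = \sum_(k < n) c k.
Proof.
exists (vrank E).+1, (fun k => Section (section_part_subproof a k)).
split=> [k x s /negbTE sk|]; first by rewrite /= sk mul0r.
apply: section_ext => x s.
rewrite [RHS](section_sumE _ (fun k => Section (section_part_subproof a k))).
rewrite /= -big_distrl /=.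
have [se|se] := ltnP (size s) (vrank E).+1.
  rewrite (bigD1 (Ordinal se)) //= eqxx big1 ?addr0 ?mul1r // => i /negbTE.
  by rewrite -val_eqE /= eq_sym => ->.
have [e spe] := fib_span x; have [aa _ _] := sfunP a.
by rewrite (alternating_vanish (aa x) spe) ?mulr0.
Qed.

Fact section_deg_free n (c : nat -> section W) :
  (forall k, section_deg k (c k)) -> \sum_(k < n) c k = 0 ->
  forall k, (k < n)%N -> c k = 0.
Proof.
move=> dc cE k kn; apply: section_ext => x s.
have [sk|sk] := eqVneq (size s) k; last by rewrite dc.
have H : (\sum_(k < n) c k) x s = 0 by rewrite cE.
rewrite -[RHS]/(0 : R) -H.
rewrite (section_sumE _ c) (bigD1 (Ordinal kn)) //= big1 ?addr0 // => i.
by rewrite -val_eqE /= -sk eq_sym => ?; rewrite dc.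
Qed.

Fact section_comm m n a b : section_deg m a -> section_deg n b ->
  section_mul a b = (-1) ^+ (m * n) *: section_mul b a.
Proof.
move=> da db; apply: section_ext => x s; rewrite section_scaleE.
exact: wedge_comm.
Qed.

Definition section_gcalg : gcalg R :=
  GCAlg section_mulA section_mul1l section_mul1r section_mul_linl
    section_mul_linr section_deg0 section_deg_lin section_deg_one
    section_degM section_deg_span section_deg_free section_comm.

End Zmod.
End Sections.

Section SectionSheaf.
Variables (R : realType) (E : vbundle R).
Local Notation M := (vbase E).
Implicit Types (U V W : set M).

Fact section_res_subproof U V (VU : V `<=` U) (a : section U) :
  is_section V (fun x s => if `[< V x >] then a x s else 0).
Proof.
have [aa za sa] := sfunP a; split.
- by move=> x; case: asboolP => _; [exact: aa|exact: alternating0].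
- by move=> x s Vx; case: asboolP.
- move=> t I vt; have oV := open_secdom V vt.
  apply: smooth_ext oV _ (smooth_sub _ (sa t I vt)).
    by move=> x [/interior_subset Vx _]; case: asboolP.
  by apply: setSI; exact: interiorS.
Qed.
Definition section_res U V (VU : V `<=` U) (a : section_gcalg U) :
  section_gcalg V := Section (section_res_subproof VU a).

Lemma section_resE U V (VU : V `<=` U) (a : section_gcalg U) x s :
  V x -> section_res VU a x s = (a : section U) x s.
Proof. by move=> Vx /=; case: asboolP. Qed.

Lemma section_ext_in U (a b : section U) :
  (forall x s, U x -> a x s = b x s) -> a = b.
Proof.
move=> ab; apply: section_ext => x s.
have [_ za _] := sfunP a; have [_ zb _] := sfunP b.
by have [/ab//|Ux] := pselect (U x); rewrite za // zb.
Qed.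

Fact section_res_morph U V (VU : V `<=` U) : gmorph (section_res VU).
Proof.
split.
- move=> k a b; apply: section_ext_in => x s Vx.
  rewrite section_resE // [LHS]section_linE.
  by rewrite [RHS]section_linE !section_resE.
- apply: section_ext_in => x s Vx; rewrite section_resE //=.
  by have Ux := VU _ Vx; do 2 case: asboolP => //.
- move=> a b; apply: section_ext_in => x s Vx; rewrite section_resE //=.
  by congr (wedge _ _ s); apply/funext => r; case: asboolP.
- by move=> n a da; move=> x s sn /=; case: asboolP => // _; exact: da.
Qed.

Fact section_glue U (I : Type) (V : I -> set M) (VU : forall i, V i `<=` U)
    (s : forall i, section_gcalg (V i)) :
  (forall i, open (V i)) -> U = \bigcup_i V i ->
  (forall i j, section_res (@subIsetl _ (V i) (V j)) (s i) =
               section_res (@subIsetr _ (V i) (V j)) (s j)) ->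
  exists! x : section_gcalg U, forall i, section_res (VU i) x = s i.
Proof.
move=> oV UE cs; have oU : open U by rewrite UE; exact: bigcup_open.
have csE i j x l : V i x -> V j x -> (s i : section _) x l = (s j : section _) x l.
  move=> ix jx; rewrite -(section_resE (@subIsetl _ (V i) (V j))) //.
  by rewrite cs section_resE.
pose f x l : R := if pselect (exists i, V i x) is left h
  then (s (projT1 (cid h)) : section _) x l else 0.
have fE i x l : V i x -> f x l = (s i : section _) x l.
  rewrite /f => ix; case: pselect => [h|[]]; last by exists i.
  by apply: csE => //; exact: projT2 (cid h).
have Ps : is_section U f.
  split.
  - move=> x; rewrite /f; case: pselect => [h|_]; last exact: alternating0.
    by have [aa _ _] := sfunP (s (projT1 (cid h)) : section _); exact: aa.
  - move=> x l; rewrite UE => nU; rewrite /f; case: pselect => // h.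
    by case: nU; case: h => i ix; exists i.
  - move=> t J vt; apply: smooth_local => x [/interior_subset + tx].
    rewrite {1}UE => -[i _ ix]; have [_ _ si] := sfunP (s i : section _).
    exists (V i `&` tdom t); first by [].
    apply: smooth_ext (smooth_sub _ (si t J vt)).
    + by apply: openI => //; exact: v_open.
    + by move=> y [iy _]; rewrite (fE i).
    + by rewrite (interior_id _).1.
exists (Section Ps : section_gcalg U); split.
  move=> i; apply: section_ext_in => x l ix; rewrite section_resE //=; exact: fE.
move=> y yE; apply: section_ext_in => x l; rewrite {1}UE => -[i _ ix] /=.
by rewrite (fE i) // -yE section_resE.
Qed.

Fact section_res_id U (UU : U `<=` U) s : open U -> section_res UU s = s.
Proof. by move=> _; apply: section_ext_in => x l Ux; rewrite section_resE. Qed.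

Fact section_res_comp U V W (VU : V `<=` U) (WV : W `<=` V) (WU : W `<=` U) s :
  open U -> open V -> open W ->
  section_res WV (section_res VU s) = section_res WU s.
Proof.
move=> _ _ _; apply: section_ext_in => x l Wx.
by rewrite !section_resE //; exact: WV.
Qed.

(* The sheaf of sections of /\^. E^*. *)
Definition section_sheaf : gsheaf R M :=
  GSheaf (fun U V VU _ _ => section_res_morph VU) section_res_id
    section_res_comp section_glue.

End SectionSheaf.

(* The sheaf C^oo (x) /\^. R^m on M: for the trivial bundle of fibre R^m, a section
   over V is a C^oo function on V with values in /\^. (R^m)^*, where R^m is
   identified with its dual by means of the canonical basis. *)
Definition free_sheaf (R : realType) (M : manifold R) (m : nat) : gsheaf R M :=
  section_sheaf (trivial_vbundle M m).

(* N-graded manifolds of degree 1, of dimension (mdim obody | orank). *)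
Record onemfd (R : realType) := OneMfd {
  obody : manifold R;
  orank : nat;
  osheaf : gsheaf R obody;
  oloc : forall p : obody, exists U, [/\ open U, U p &
    sheaf_iso_on U osheaf (free_sheaf obody orank)] }.

Section LocalTriviality.
Variables (R : realType) (E : vbundle R).
Local Notation M := (vbase E).
Local Notation T := (trivial_vbundle M (vrank E)).
Variable t : triv (@vfib _ E) (vrank E).
Hypothesis vt : vtrivs t.

Lemma linear_bwd x : tdom t x -> linear (@tbwd _ _ _ _ t x).
Proof.
move=> tx k u v; apply: (can_inj (v_fwdK vt tx)).
by rewrite (v_lin vt tx) !(v_bwdK vt tx).
Qed.

Section OnW.
Variables (W : set M) (Wt : W `<=` tdom t).

Fact triv_fwd_subproof (a : section W) : @is_section R T W
  (fun x s => if `[< W x >] then a x (map (tbwd t x) s) else 0).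
Proof.
have [aa za sa] := sfunP a; split.
- move=> x; case: asboolP => [Wx|_]; last exact: alternating0.
  by apply: alternating_map => //; exact: linear_bwd (Wt Wx).
- by move=> x s Wx; case: asboolP.
- move=> _ I ->; have oW := open_secdom W vt.
  apply: (@smooth_ext _ _ _ (fun x => a x (map (tframe t x) I))).
  + apply: openI; [exact: open_interior|exact: openT].
  + move=> x [/interior_subset Wx _]; case: asboolP => // _.
    by congr (a x _); rewrite -map_comp; exact: eq_map.
  + apply: smooth_sub (sa t I vt) => x [oWx _]; split=> //.
    by apply: Wt; exact: interior_subset oWx.
Qed.
Definition triv_fwd (a : section_gcalg W) : @section_gcalg R T W :=
  Section (triv_fwd_subproof a).

Fact triv_bwd_subproof (b : @section R T W) : @is_section R E W
  (fun x s => if `[< W x >] then b x (map (@tfwd _ _ _ _ t x) s) else 0).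
Proof.
have [ab zb sb] := sfunP b; split.
- move=> x; case: asboolP => [Wx|_]; last exact: alternating0.
  by apply: alternating_map; [exact: (v_lin vt (Wt Wx))|exact: (ab x)].
- by move=> x s Wx; case: asboolP.
- move=> t' I vt'; have oW := open_secdom W vt'.
  have sW : W^° `&` tdom t' `<=` tdom t' `&` tdom t.
    by move=> x [/interior_subset/Wt ? ?].
  apply: (@smooth_ext _ _ _ (fun x => b x (map (fun i => tfwd t (tframe t' x i)) I))).
  + exact: oW.
  + by move=> x [/interior_subset Wx _]; case: asboolP => // _; rewrite -map_comp.
  + apply: (@smooth_expand R M (fun=> 'rV[R]_(vrank E)) _ (vrank E) (fun _ j => delta_mx 0 j) b _ (fun i x => tfwd t (tframe t' x i)) (fun i j x => tfwd t (tframe t' x i) 0 j)) => //.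
    * move=> J; apply: smooth_sub (sb _ J erefl) => x [? _]; split=> //.
    * by move=> i j; apply: smooth_sub sW (v_trans _ _ _ _).
    * by move=> i x _; exact: row_sum_delta.
Qed.
Definition triv_bwd (b : @section_gcalg R T W) : section_gcalg W :=
  Section (triv_bwd_subproof b).

Lemma triv_fwdE a x s : W x ->
  triv_fwd a x s = (a : section W) x (map (tbwd t x) s).
Proof. by move=> Wx /=; case: asboolP. Qed.

Lemma triv_bwdE (b : @section_gcalg R T W) x s : W x ->
  triv_bwd b x s = (b : @section R T W) x (map (@tfwd _ _ _ _ t x) s).
Proof. by move=> Wx /=; case: asboolP. Qed.

Lemma triv_fwd_bij : bijective triv_fwd.
Proof.
exists triv_bwd => [a|b]; apply: section_ext_in => x s Wx.
  rewrite triv_bwdE // triv_fwdE // -map_comp map_id_in // => v _ /=.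
  exact: v_fwdK vt (Wt Wx) _.
rewrite triv_fwdE // triv_bwdE // -map_comp map_id_in // => v _ /=.
exact: v_bwdK vt (Wt Wx) _.
Qed.

Lemma triv_fwd_morph : gmorph triv_fwd.
Proof.
split.
- move=> k a b; apply: section_ext_in => x s Wx.
  by rewrite triv_fwdE // [LHS]section_linE [RHS]section_linE !triv_fwdE.
- apply: section_ext_in => x s Wx; rewrite triv_fwdE //=.
  by case: asboolP => // _; rewrite /form1; case: s.
- move=> a b; apply: section_ext_in => x s Wx; rewrite triv_fwdE //=.
  by rewrite wedge_map; congr (wedge _ _ s); apply/funext => r; case: asboolP.
- move=> n a da; move=> x s sn /=; case: asboolP => // _.
  by apply: da; rewrite size_map.
Qed.

End OnW.

Lemma section_sheaf_triv :
  sheaf_iso_on (tdom t) (section_sheaf E) (section_sheaf T).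
Proof.
exists (fun V a => if pselect (V `<=` tdom t) is left h then triv_fwd h a else 0).
split=> [V oV VU|V W WV oV oW VU s].
  by case: pselect => // h; split; [exact: triv_fwd_morph|exact: triv_fwd_bij].
case: pselect => [hW|[]]; last exact: subset_trans WV VU.
case: pselect => // hV; apply: section_ext_in => x l Wx.
rewrite triv_fwdE // [RHS](@section_resE _ T) // (triv_fwdE hV) //; last exact: WV.
by rewrite [LHS]section_resE.
Qed.

End LocalTriviality.

Lemma section_sheaf_loc (R : realType) (E : vbundle R) (p : vbase E) :
  exists U, [/\ open U, U p &
    sheaf_iso_on U (section_sheaf E) (free_sheaf (vbase E) (vrank E))].
Proof.
have [t vt tp] := v_cover p; exists (tdom t); split=> //; first exact: v_open.
exact: section_sheaf_triv.
Qed.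

(* E[1] = (M, Gamma(/\^. E^* )). *)
Definition shift_obj (R : realType) (E : vbundle R) : onemfd R :=
  OneMfd (@section_sheaf_loc R E).

Lemma lin_sum (R : realType) (V W : lmodType R) (f : V -> W) (r : nat)
    (c : 'I_r -> R) (e : 'I_r -> V) : linear f ->
  f (\sum_i c i *: e i) = \sum_i c i *: f (e i).
Proof.
move=> lf; pose L := GRing.isLinear.Build _ _ _ _ _ lf.
pose g : {linear _ -> _} := HB.pack f L.
rewrite -[LHS]/(g _) linear_sum; apply: eq_bigr => i _; exact: linearZ.
Qed.

Lemma frame_expand (R : realType) (E : vbundle R)
    (t : triv (@vfib _ E) (vrank E)) x (v : vfib x) :
  vtrivs t -> tdom t x -> v = \sum_j tfwd t v 0 j *: tframe t x j.
Proof.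
move=> vt tx; apply: (can_inj (v_fwdK vt tx)).
rewrite (lin_sum _ _ (v_lin vt tx)) [LHS]row_sum_delta; apply: eq_bigr => j _.
by rewrite (v_bwdK vt tx).
Qed.

Section VectMorphisms.
Variable R : realType.

(* Vector bundle morphisms Phi covering f: fibrewise linear, with smooth matrix
   entries in local trivialisations, i.e. smooth on the total spaces. *)
Definition is_vmor (E F : vbundle R) (f : vbase E -> vbase F)
    (Phi : forall x : vbase E, vfib x -> vfib (f x)) : Prop :=
  [/\ smooth_map f,
      forall x, linear (Phi x) &
      forall (t : triv (@vfib _ E) (vrank E)) (u : triv (@vfib _ F) (vrank F)) i j,
        vtrivs t -> vtrivs u ->
        smooth_fun (tdom t `&` f @^-1` tdom u)
          (fun x => tfwd u (Phi x (tframe t x i)) 0 j)].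

Record vmor (E F : vbundle R) := VMor {
  vmbase : vbase E -> vbase F;
  vmfib : forall x : vbase E, vfib x -> vfib (vmbase x);
  vmorP : is_vmor vmfib }.

Fact vmor_id_subproof (E : vbundle R) :
  @is_vmor E E id (fun x => id).
Proof.
by split=> [|//|t u i j vt vu]; [exact: smooth_map_id|exact: v_trans].
Qed.
Definition vmor_id E : vmor E E := VMor (vmor_id_subproof E).

Fact vmor_comp_subproof E F G (g : vmor F G) (f : vmor E F) :
  @is_vmor E G (vmbase g \o vmbase f)
    (fun x v => vmfib g (vmfib f v)).
Proof.
have [sf lf cf] := vmorP f; have [sg lg cg] := vmorP g; split.
- exact: smooth_map_comp.
- by move=> x k u v; rewrite lf lg.
move=> t w i j vt vw; apply: smooth_local => x [tx wx].
have [u vu ux] := v_cover (vmbase f x).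
pose O : set (vbase F) := tdom u `&` vmbase g @^-1` tdom w.
have oO : open O.
  by apply: openI; [exact: v_open|apply: open_preim => //; exact: v_open].
exists (tdom t `&` vmbase f @^-1` O); first by [].
have oD : open (tdom t `&` vmbase f @^-1` O).
  by apply: openI; [exact: v_open|exact: open_preim].
apply: (@smooth_ext _ _ _ (fun y => \sum_k
    tfwd u (vmfib f (tframe t y i)) 0 k *
    ((fun z => tfwd w (vmfib g (tframe u z k)) 0 j) \o vmbase f) y)) => //.
  move=> y [ty [uy wy]].
  rewrite [in RHS](frame_expand (vmfib f (tframe t y i)) vu uy).
  rewrite (lin_sum _ _ (lg _)) (lin_sum _ _ (v_lin vw wy)) summxE.
  by apply: eq_bigr => k _; rewrite mxE.
apply: smooth_sum => // k; apply: smoothM => //.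
  by apply: smooth_sub (cf t u i k vt vu) => y [ty []].
apply: smooth_sub (smooth_pull sf oO (cg u w k j vu vw)).
exact: subIsetr.
Qed.
Definition vmor_comp E F G (g : vmor F G) (f : vmor E F) : vmor E G :=
  VMor (vmor_comp_subproof g f).

Lemma vmor_eq E F (f : vbase E -> vbase F)
    (Phi : forall x : vbase E, vfib x -> vfib (f x)) (p q : is_vmor Phi) :
  VMor p = VMor q.
Proof. by congr VMor; exact: Prop_irrelevance. Qed.

End VectMorphisms.

Section OneMorphisms.
Variable R : realType.
Implicit Types X Y Z : onemfd R.

(* Pairs (f, f^#) with f^# : C(Y) -> f_* C(X), where f_* C(X) (V) is
   C(X) (f @^-1` V). *)
Definition is_omor X Y (f : obody X -> obody Y)
    (fs : forall V, open V -> gsec (osheaf Y) V -> gsec (osheaf X) (f @^-1` V)) :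
    Prop :=
  [/\ smooth_map f,
      forall V (oV : open V), gmorph (fs V oV) &
      forall V W (oV : open V) (oW : open W) (WV : W `<=` V)
        (WV' : f @^-1` W `<=` f @^-1` V) s,
        fs W oW (gres WV s) = gres WV' (fs V oV s)].

Record omor X Y := OMor {
  ombase : obody X -> obody Y;
  omsharp : forall V, open V ->
    gsec (osheaf Y) V -> gsec (osheaf X) (ombase @^-1` V);
  omorP : is_omor omsharp }.

Lemma om_open X Y (f : omor X Y) V : open V -> open (ombase f @^-1` V).
Proof. by have [sf _ _] := omorP f; exact: open_preim. Qed.

Fact omor_id_subproof X : @is_omor X X id (fun V _ s => s).
Proof.
split=> [|V oV|V W oV oW WV WV' s]; first exact: smooth_map_id.
  by split.
by congr gres; exact: Prop_irrelevance.
Qed.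
Definition omor_id X : omor X X := OMor (omor_id_subproof X).

Lemma gmorph_comp (A B C : gcalg R) (f : A -> B) (g : B -> C) :
  gmorph f -> gmorph g -> gmorph (g \o f).
Proof.
move=> [lf f1 fM fd] [lg g1 gM gd]; split=> [k a b||a b|n a da] /=.
- by rewrite lf lg.
- by rewrite f1.
- by rewrite fM.
- by apply: gd; exact: fd.
Qed.

Fact omor_comp_subproof X Y Z (g : omor Y Z) (f : omor X Y) :
  @is_omor X Z (ombase g \o ombase f)
    (fun V oV s => omsharp f (om_open g oV) (omsharp g oV s)).
Proof.
have [sf mf nf] := omorP f; have [sg mg ng] := omorP g; split.
- exact: smooth_map_comp.
- move=> V oV; exact: gmorph_comp (mg V oV) (mf _ _).
move=> V W oV oW WV WV' s.
have WV2 : ombase g @^-1` W `<=` ombase g @^-1` V by move=> x; exact: WV.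
by rewrite (ng _ _ oV oW WV WV2) (nf _ _ (om_open g oV) (om_open g oW) WV2 WV').
Qed.
Definition omor_comp X Y Z (g : omor Y Z) (f : omor X Y) : omor X Z :=
  OMor (omor_comp_subproof g f).

Lemma omor_eq X Y (f : obody X -> obody Y)
    (fs gs : forall V, open V -> gsec (osheaf Y) V -> gsec (osheaf X) (f @^-1` V))
    (p : is_omor fs) (q : is_omor gs) :
  (forall V (oV : open V) s, fs V oV s = gs V oV s) -> OMor p = OMor q.
Proof.
move=> e; have {}e : fs = gs.
  by do 2![apply: functional_extensionality_dep => ?]; apply/funext => s; exact: e.
by case: gs / e q => q; congr OMor; exact: Prop_irrelevance.
Qed.

End OneMorphisms.

Record category := Category {
  ob : Type;
  hom : ob -> ob -> Type;
  idm : forall X, hom X X;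
  compm : forall X Y Z, hom Y Z -> hom X Y -> hom X Z;
  comp1m : forall X Y (f : hom X Y), compm (idm Y) f = f;
  compm1 : forall X Y (f : hom X Y), compm f (idm X) = f;
  compmA : forall X Y Z T (h : hom Z T) (g : hom Y Z) (f : hom X Y),
    compm h (compm g f) = compm (compm h g) f }.

Record functor (C D : category) := Functor {
  fob :> ob C -> ob D;
  fhom : forall X Y, hom X Y -> hom (fob X) (fob Y);
  fhom1 : forall X, fhom (idm X) = idm (fob X);
  fhomM : forall X Y Z (g : hom Y Z) (f : hom X Y),
    fhom (compm g f) = compm (fhom g) (fhom f) }.

Definition functor_id (C : category) : functor C C :=
  @Functor C C id (fun _ _ f => f) (fun _ => erefl) (fun _ _ _ _ _ => erefl).

Section FunctorComp.
Variables (C D E : category) (G : functor D E) (F : functor C D).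

Fact functor_comp_id X : fhom G (fhom F (idm X)) = idm (G (F X)).
Proof. by rewrite !fhom1. Qed.

Fact functor_comp_comp X Y Z (g : hom Y Z) (f : hom X Y) :
  fhom G (fhom F (compm g f)) = compm (fhom G (fhom F g)) (fhom G (fhom F f)).
Proof. by rewrite !fhomM. Qed.

Definition functor_comp : functor C E :=
  Functor functor_comp_id functor_comp_comp.

End FunctorComp.

Definition is_iso (C : category) (X Y : ob C) (f : hom X Y) : Prop :=
  exists g : hom Y X, compm g f = idm X /\ compm f g = idm Y.

Definition nat_isomorphic (C D : category) (F G : functor C D) : Prop :=
  exists eta : forall X, hom (F X) (G X),
    (forall X, is_iso (eta X)) /\
    (forall X Y (f : hom X Y), compm (eta Y) (fhom F f) = compm (fhom G f) (eta X)).

Definition is_equivalence (C D : category) (F : functor C D) : Prop :=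
  exists G : functor D C,
    nat_isomorphic (functor_comp G F) (functor_id C) /\
    nat_isomorphic (functor_comp F G) (functor_id D).

Section Categories.
Variable R : realType.

Fact vmor_comp1m (E F : vbundle R) (f : vmor E F) :
  vmor_comp (vmor_id F) f = f.
Proof. by case: f => f Phi P; exact: vmor_eq. Qed.

Fact vmor_compm1 (E F : vbundle R) (f : vmor E F) :
  vmor_comp f (vmor_id E) = f.
Proof. by case: f => f Phi P; exact: vmor_eq. Qed.

Fact vmor_compmA (E F G H : vbundle R) (h : vmor G H) (g : vmor F G) (f : vmor E F) :
  vmor_comp h (vmor_comp g f) = vmor_comp (vmor_comp h g) f.
Proof. exact: vmor_eq. Qed.

Definition Vect : category := Category vmor_comp1m vmor_compm1 vmor_compmA.

Fact omor_comp1m (X Y : onemfd R) (f : omor X Y) : omor_comp (omor_id Y) f = f.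
Proof.
case: f => f fs P; apply: omor_eq => V oV s /=.
by congr (fs V _ s); exact: Prop_irrelevance.
Qed.

Fact omor_compm1 (X Y : onemfd R) (f : omor X Y) : omor_comp f (omor_id X) = f.
Proof. by case: f => f fs P; exact: omor_eq. Qed.

Fact omor_compmA (X Y Z T : onemfd R) (h : omor Z T) (g : omor Y Z) (f : omor X Y) :
  omor_comp h (omor_comp g f) = omor_comp (omor_comp h g) f.
Proof.
apply: omor_eq => V oV s /=.
by congr (omsharp f _ _); exact: Prop_irrelevance.
Qed.

Definition OneMan : category := Category omor_comp1m omor_compm1 omor_compmA.

End Categories.

Section Shift.
Variable R : realType.
Implicit Types E F G : vbundle R.

Section OnMorphisms.
Variables (E F : vbundle R) (Phi : vmor E F).
Local Notation phi := (vmbase Phi).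

Fact shift_sharp_subproof V (oV : open V) (s : section V) :
  @is_section R E (phi @^-1` V) (fun x l => s (phi x) (map (vmfib Phi (x:=x)) l)).
Proof.
have [as_ zs ss] := sfunP s; have [sf lf cf] := vmorP Phi; split.
- by move=> x; apply: alternating_map.
- by move=> x l Vx; rewrite zs.
move=> t I vt; apply: smooth_local => x [/interior_subset Vx tx].
have [u vu ux] := v_cover (phi x).
have oVu := open_secdom V vu.
have oD : open (tdom t `&` phi @^-1` (V^° `&` tdom u)).
  by apply: openI; [exact: v_open|exact: open_preim].
exists (tdom t `&` phi @^-1` (V^° `&` tdom u)).
  by rewrite (interior_id _).1.
apply: (@smooth_ext _ _ _ (fun y => s (phi y) (map (fun i => vmfib Phi (tframe t y i)) I))) => //.
  by move=> y _; rewrite -map_comp.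
apply: (@smooth_expand R (vbase E) (fun y => vfib (phi y)) _ (vrank F)
  (fun y => tframe u (phi y)) (fun y => s (phi y)) _
  (fun i y => vmfib Phi (tframe t y i))
  (fun i j y => tfwd u (vmfib Phi (tframe t y i)) 0 j)) => //.
- move=> J; apply: smooth_sub (smooth_pull sf oVu (ss u J vu)).
  exact: subIsetr.
- by move=> i j; apply: smooth_sub (cf t u i j vt vu) => y [ty []].
- by move=> i y [_ [_ uy]]; exact: frame_expand.
Qed.

(* The pull-back s |-> /\^. Phi^* o s o phi. *)
Definition shift_sharp V (oV : open V) (s : section_gcalg V) :
  @section_gcalg R E (phi @^-1` V) := Section (shift_sharp_subproof oV s).

Fact shift_hom_subproof :
  @is_omor R (shift_obj E) (shift_obj F) phi shift_sharp.
Proof.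
split; first by have [] := vmorP Phi.
- move=> V oV; split.
  + move=> k a b; apply: section_ext => x l /=.
    by rewrite [LHS]section_linE [RHS]section_linE.
  + apply: section_ext => x l /=.
    by rewrite /form1; case: l.
  + by move=> a b; apply: section_ext => x l; exact: wedge_map.
  + by move=> n a da x l ln /=; apply: da; rewrite size_map.
- by move=> V W oV oW WV WV' s; apply: section_ext_in => x l Wx.
Qed.

Definition shift_hom : @hom (OneMan R) (shift_obj E) (shift_obj F) :=
  OMor shift_hom_subproof.

End OnMorphisms.

Fact shift_hom_id E : shift_hom (vmor_id E) = omor_id (shift_obj E).
Proof.
by apply: omor_eq => V oV s; apply: section_ext => x l /=; rewrite map_id.
Qed.

Fact shift_hom_comp E F G (g : vmor F G) (f : vmor E F) :
  shift_hom (vmor_comp g f) = omor_comp (shift_hom g) (shift_hom f).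
Proof.
apply: omor_eq => V oV s; apply: section_ext => x l /=.
by rewrite -map_comp.
Qed.

(* The functor [1]. *)
Definition shift1 : functor (Vect R) (OneMan R) :=
  @Functor (Vect R) (OneMan R) (@shift_obj R) shift_hom shift_hom_id shift_hom_comp.

End Shift.

(* Main.v *)
Require Import Defs.
From mathcomp Require Import all_boot all_order all_algebra.
From mathcomp Require Import boolp classical_sets functions reals.
From mathcomp Require Import topology normedtype derive.

(** The functor is shown to be fully faithful and essentially surjective.

    A morphism $E[1] \to F[1]$ is a smooth map $\varphi$ together with a morphism of
    sheaves $f^\sharp$ from sections of $\wedge F^\vee$ to sections of
    $\wedge E^\vee$. In degree $0$ it can only be the pull-back of functions: if
    $f^\sharp(s)(x) = c$ differed from $s(\varphi(x))$, then $s - c$ would be invertible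
    near $\varphi(x)$ while its image vanishes at $x$ ([sheaf_mor_deg0]). In degree $1$
    the images of a local dual frame $(\epsilon^j)$ of $F$ are the components of a
    fibrewise linear map $\Phi$, whence smoothness. The pull-back by $\Phi$ and
    $f^\sharp$ are both morphisms of algebras, and by Euler's identity
    $k s = \sum_j \epsilon^j \wedge i_{e_j} s$ for $s$ of degree $k$
    ([euler_identity]) the algebra is locally generated by functions and the
    $\epsilon^j$; so the two agree ([sheaf_mor_pullback]). This gives fullness, and
    faithfulness holds because $\Phi$ is recovered from the pull-backs of the
    $\epsilon^j$.

    For essential surjectivity, a trivialisation of the structure sheaf of $X$ is
    chosen around each point. By the same result, applied to the identity of the
    base over an overlap, changes of trivialisation are pull-backs by smooth families of
    linear maps; these satisfy the cocycle relation and define a vector bundle whose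
    fibre at $x$ is $\mathbb{R}^m$ in the coordinates chosen at $x$. Reading an element
    of the sheaf at $x$ in these coordinates gives the isomorphism with the sections
    of the bundle ([assoc_iso]); it is bijective by gluing. *)

Set Implicit Arguments.
Unset Strict Implicit.
Unset Printing Implicit Defensive.
Import Order.TTheory GRing.Theory Num.Theory numFieldNormedType.Exports.
Local Open Scope classical_set_scope.
Local Open Scope ring_scope.

(** * Inverses of smooth functions *)

Lemma CkV (R : realType) n k (U : set 'rV[R]_n) (f : 'rV[R]_n -> R) :
  open U -> (forall x, U x -> f x != 0) -> Ck k U f ->
  Ck k U (fun x => (f x)^-1).
Proof.
move=> oU f0; elim: k => [|k IH] cf.
  by move=> x Ux; exact: (cvgV (f0 x Ux) (cf x Ux)).
have cV := IH (CkS cf); have [df dcf] := cf; split=> [x Ux|i].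
  by apply: differentiableV; [exact: df|exact: f0].
apply: Ck_ext (CkM oU (Ck_cst k U (-1)) (CkM oU (CkM oU cV cV) (dcf i))) => //.
move=> x Ux; rewrite deriveV ?f0 //; last exact/diff_derivable/df.
rewrite -[LHS]/(-1 * ((f x)^-1 * (f x)^-1 * 'D_(delta_mx 0 i) f x)).
by rewrite -[RHS]/(- (f x) ^- 2 * _) mulN1r mulNr -invfM expr2.
Qed.

Lemma smoothV (R : realType) (M : manifold R) (W : set M) (f : M -> R) :
  open W -> (forall x, W x -> f x != 0) -> smooth_fun W f ->
  smooth_fun W (fun x => (f x)^-1).
Proof.
move=> oW f0 sf c ac k; apply: (CkV _ _ (sf c ac k)); first exact: open_cimg.
by move=> y /(cimgP _ _ ac)[_ Wy _]; exact: f0.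
Qed.

Lemma smooth_continuous (R : realType) (M : manifold R) (W : set M) (f : M -> R) :
  open W -> smooth_fun W f -> {in W, continuous f}.
Proof.
move=> oW sf x /set_mem Wx; have [c ac dx] := m_cover x.
have [od _ K cf _] := m_charts ac.
have cx : cimg c W (cfwd c x) by exists x.
have cfx := cf x (mem_set dx).
rewrite /prop_for /continuous_at.
have -> : f x = (f \o cbwd c) (cfwd c x) by rewrite /= K.
apply: cvg_trans (continuous_comp cfx (sf c ac 0%N _ cx)).
apply: (@near_eq_cvg _ _ (nbhs x)).
by apply: filterS (open_nbhs_nbhs (conj od dx)) => y dy /=; rewrite K.
Qed.

Lemma open_smooth_neq0 (R : realType) (M : manifold R) (W : set M) (f : M -> R) :
  open W -> smooth_fun W f -> open (W `&` [set x | f x != 0]).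
Proof.
move=> oW sf.
have := ((continuous_inP _ oW).1 (smooth_continuous oW sf)) [set y | y != 0].
by apply; exact: open_neq.
Qed.

(** * Contractions of alternating forms *)

Section Contraction.
Variables (R : realType) (V : lmodType R).
Implicit Types (w b : seq V -> R) (u v : V) (s : seq V).

Lemma alternating_contr v w : alternating w -> alternating (contr v w).
Proof.
move=> [lw aw]; split=> [s t k x y|s1 s2 s3 x].
  by rewrite /contr -!cat_cons lw.
by rewrite /contr -cat_cons aw.
Qed.

Lemma alternating_linear_form (a : V -> R) :
  (forall (k : R) x y, a (k *: x + y) = k * a x + a y) ->
  alternating (fun s => if s is [:: x] then a x else 0).
Proof.
move=> la; split=> [[|? [|? ?]] [|? ?] k x y|[|? [|? ?]] [|? ?] s3 x] //=.
all: by rewrite mulr0 addr0.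
Qed.

Lemma alternatingN u v w s : alternating w -> w (u :: v :: s) = - w (v :: u :: s).
Proof.
move=> [lw aw].
have D1 x y z t : w (x + y :: z :: t) = w (x :: z :: t) + w (y :: z :: t).
  by have := lw [::] (z :: t) 1 x y; rewrite scale1r mul1r.
have D2 x y z t : w (z :: x + y :: t) = w (z :: x :: t) + w (z :: y :: t).
  by have := lw [:: z] t 1 x y; rewrite scale1r mul1r.
have A x : w (x :: x :: s) = 0 by exact: (aw [::] [::]).
by apply/eqP; rewrite -addr_eq0; have := A (u + v);
  rewrite D1 !D2 !A add0r addr0 => ->.
Qed.

(** In the antiderivation rule for $i_v$, a first factor of degree $1$ contributes a
    scalar and the sign $-1$. *)
Lemma wedge_linear_form_cons (a : V -> R) b v s :
  wedge (fun r => if r is [:: x] then a x else 0) b (v :: s) =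
  a v * b s - wedge (fun r => if r is [:: x] then a x else 0) (contr v b) s.
Proof.
rewrite wedge_cons.
have -> : contr v (fun r => if r is [:: x] then a x else 0) =
    (fun r => a v * form1 r).
  by apply/funext => -[|? ?]; rewrite /contr /form1 ?mulr1 ?mulr0.
rewrite wedgeZl wedge1l -mulN1r -wedgeZl.
congr (_ + wedge _ _ s); apply/funext => -[|? [|? ?]] /=.
all: by rewrite /gsgn /= ?expr0 ?expr1 ?mulr0.
Qed.

(** Euler's identity $\sum_j \epsilon^j \wedge i_{e_j} w = |w| w$, where $(\epsilon^j)$
    is dual to $(e_j)$. Contraction is an antiderivation, so contracting the
    left-hand side with $v$ gives the same sum for $i_v w$ plus
    $\sum_j \epsilon^j(v) i_{e_j} w = i_v w$; hence the induction on $|w|$. *)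
Lemma euler_identity (r : nat) (e : 'I_r -> V) (eps : 'I_r -> V -> R) w s :
  (forall v, v = \sum_j eps j v *: e j) -> alternating w ->
  \sum_j wedge (fun t => if t is [:: x] then eps j x else 0) (contr (e j) w) s
  = (size s)%:R * w s.
Proof.
move=> eE; elim: s w => [|v s IH] w aw.
  by rewrite mul0r big1 // => j _; rewrite /= mul0r.
under eq_bigr do rewrite wedge_linear_form_cons.
rewrite big_split /=.
have -> : \sum_j eps j v * contr (e j) w s = w (v :: s).
  by rewrite [in RHS](eE v) -(alternating_sum aw (eps^~ v) e [::] s).
under [X in _ + X]eq_bigr => j _.
  rewrite -mulN1r -wedgeZr.
  have -> : (fun t => -1 * contr v (contr (e j) w) t) = contr (e j) (contr v w).
    by apply/funext => t; rewrite mulN1r /contr -alternatingN.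
  over.
by rewrite IH; [rewrite -natr1 mulrDl mul1r addrC|exact: alternating_contr].
Qed.

End Contraction.

(** * Graded algebra morphisms *)

Lemma gmorph0 (R : realType) (A B : gcalg R) (f : A -> B) : gmorph f -> f 0 = 0.
Proof.
by case=> lf _ _ _; have := lf (-1) 0 0; rewrite scaler0 addr0 scaleN1r addNr.
Qed.

Lemma gmorphZ (R : realType) (A B : gcalg R) (f : A -> B) (k : R) (a : A) :
  gmorph f -> f (k *: a) = k *: f a.
Proof.
by move=> mf; have [lf _ _ _] := mf; rewrite -[k *: a]addr0 lf gmorph0 // addr0.
Qed.

Lemma gmorph_sum (R : realType) (A B : gcalg R) (f : A -> B) (I : finType)
    (a : I -> A) : gmorph f -> f (\sum_i a i) = \sum_i f (a i).
Proof.
move=> mf; have [lf _ _ _] := mf; apply: (big_morph f) => [x y|].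
  by rewrite -[x]scale1r lf !scale1r.
exact: gmorph0.
Qed.

(** The inverse map preserves degrees because the homogeneous components of an
    element are unique: those of the preimage of a homogeneous element are sent
    to zero in all other degrees. *)
Lemma gmorph_inv (R : realType) (A B : gcalg R) (f : A -> B) (g : B -> A) :
  cancel f g -> cancel g f -> gmorph f -> gmorph g.
Proof.
move=> fK gK mf; have [lf f1 fM fd] := mf; have fI := can_inj fK; split.
- by move=> k a b; apply: fI; rewrite lf !gK.
- by rewrite -f1 fK.
- by move=> a b; apply: fI; rewrite fM !gK.
move=> n b db; have [N [c [dc gbE]]] := gdeg_span (g b).
(* The sum is padded with zeros so that the degree n occurs among its indices. *)
pose c' k := if (k < N)%N then c k else 0.
have dc' k : gdeg k (c' k) by rewrite /c'; case: ifP => // _; exact: gdeg0.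
have bE : b = \sum_(k < N + n.+1) f (c' k).
  rewrite -gmorph_sum // -[LHS]gK; congr f; rewrite gbE.
  by rewrite (big_ord_widen _ c (leq_addr n.+1 N)) big_mkcond.
pose d k := f (c' k) - if k == n then b else 0.
have dd k : gdeg k (d k).
  rewrite /d addrC -scaleN1r; apply: gdeg_lin; last exact: fd.
  by case: eqP => [->//|_]; exact: gdeg0.
have nN : (n < N + n.+1)%N by rewrite addnS ltnS leq_addl.
have d0 : \sum_(k < N + n.+1) d k = 0.
  rewrite /d sumrB -bE (bigD1 (Ordinal nN)) //= eqxx big1 ?addr0 ?subrr // => i.
  by rewrite -val_eqE /= => /negbTE ->.
have /eqP := gdeg_free dd d0 nN; rewrite /d eqxx subr_eq0 => /eqP <-.
by rewrite fK.
Qed.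

(** * Functions, dual frames and contractions as sections *)

Section SpecialSections.
Variables (R : realType) (E : vbundle R).
Local Notation M := (vbase E).
Implicit Types (V W : set M) (t u : triv (@vfib _ E) (vrank E)).

Lemma section_bigE (I : finType) W (c : I -> section_gcalg W) x s :
  ((\sum_i c i : section_gcalg W) : section W) x s =
  \sum_i (c i : section W) x s.
Proof.
apply: (big_morph (fun a : section W => a x s)) => // a b.
exact: section_addE.
Qed.

Fact func_section_subproof W (f : M -> R) : open W -> smooth_fun W f ->
  @is_section R E W (fun x s => if `[< W x >] then f x * form1 s else 0).
Proof.
move=> oW sf; split.
- move=> x; case: asboolP => _; last exact: alternating0.
  have := alternating_lin (f x) (@alternating1 R (vfib x)) (@alternating0 R (vfib x)).
  by under eq_fun do rewrite addr0.
- by move=> x s Wx; case: asboolP.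
- move=> t I vt; have oWt := open_secdom W vt.
  apply: (@smooth_ext _ _ _ (fun x => f x * (I == [::])%:R)) => //.
    move=> x [/interior_subset Wx _]; case: asboolP => // _.
    by rewrite /form1; case: I.
  apply: smoothM => //; last exact: smooth_cst.
  by apply: smooth_sub sf => x [/interior_subset].
Qed.
Definition func_section W f (oW : open W) (sf : smooth_fun W f) :
  @section_gcalg R E W := Section (func_section_subproof oW sf).

Fact coframe_subproof u W j : vtrivs u -> W `<=` tdom u ->
  @is_section R E W (fun x s =>
    if `[< W x >] then (if s is [:: v] then tfwd u v 0 j else 0) else 0).
Proof.
move=> vu Wu; split.
- move=> x; case: asboolP => [Wx|_]; last exact: alternating0.
  by apply: alternating_linear_form => k v v'; rewrite (v_lin vu (Wu _ Wx)) !mxE.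
- by move=> x s Wx; case: asboolP.
- move=> t I vt; have oWt := open_secdom W vt.
  apply: (@smooth_ext _ _ _
    (fun x => if I is [:: i] then tfwd u (tframe t x i) 0 j else 0)) => //.
    move=> x [/interior_subset Wx _]; case: asboolP => // _.
    by case: I => [|? [|? ?]].
  case: I => [|i [|? ?]]; try exact: smooth_cst.
  by apply: smooth_sub (v_trans i j vt vu) => x [/interior_subset/Wu].
Qed.
(** The $j$-th element $\epsilon^j$ of the frame dual to that of [u]. *)
Definition coframe u W j (vu : vtrivs u) (Wu : W `<=` tdom u) :
  @section_gcalg R E W := Section (coframe_subproof j vu Wu).

Lemma coframeE u W j (vu : vtrivs u) (Wu : W `<=` tdom u) x v : W x ->
  (coframe j vu Wu : section W) x [:: v] = tfwd u v 0 j.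
Proof. by move=> Wx /=; case: asboolP. Qed.

Lemma coframe_deg u W j (vu : vtrivs u) (Wu : W `<=` tdom u) :
  gdeg 1 (coframe j vu Wu).
Proof. by move=> x [|? [|? ?]] //= _; case: asboolP. Qed.

Fact contr_section_subproof u W j (s : section W) : vtrivs u -> W `<=` tdom u ->
  @is_section R E W (fun x => contr (tframe u x j) (s x)).
Proof.
have [as_ zs ss] := sfunP s; move=> vu Wu; split.
- by move=> x; apply: alternating_contr.
- by move=> x l Wx; rewrite /contr zs.
- move=> t I vt; have oWt := open_secdom W vt.
  (* The vector by which s is contracted and those of the frame of t form one
     family, indexed by None and Some i, all expanded along the frame of t. *)
  pose v k x := if k is Some i then tframe t x i else tframe u x j.
  pose c k i x : R := if k is Some i' then (delta_mx 0 i' : 'rV[R]_(vrank E)) 0 i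
    else tfwd t (tframe u x j) 0 i.
  have cE k x : (W^° `&` tdom t) x -> v k x = \sum_i c k i x *: tframe t x i.
    move=> [_ tx]; rewrite {1}(frame_expand (v k x) vt tx); apply: eq_bigr => i _.
    by case: k => [i'|] //=; rewrite (v_bwdK vt tx).
  have sc k i : smooth_fun (W^° `&` tdom t) (c k i).
    case: k => [i'|]; first exact: smooth_cst.
    by apply: smooth_sub (v_trans j i vu vt) => x [/interior_subset/Wu].
  have := smooth_expand oWt as_ (fun I => ss t I vt) sc cE (None :: map Some I).
  by apply: smooth_ext => // x _ /=; rewrite -map_comp.
Qed.
Definition contr_section u W j (s : section W) (vu : vtrivs u)
  (Wu : W `<=` tdom u) : @section_gcalg R E W :=
  Section (contr_section_subproof j s vu Wu).

Lemma contr_section_deg u W j (s : section_gcalg W) (vu : vtrivs u)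
    (Wu : W `<=` tdom u) n : gdeg n.+1 s -> gdeg n (contr_section j s vu Wu).
Proof. by move=> ds x l ln; apply: ds. Qed.

Lemma section_euler u W (s : section_gcalg W) (vu : vtrivs u)
    (Wu : W `<=` tdom u) n : gdeg n s ->
  n%:R *: s = \sum_j gmul (coframe j vu Wu) (contr_section j s vu Wu).
Proof.
move=> ds; apply: section_ext_in => x l Wx.
rewrite section_scaleE section_bigE /=; case: asboolP => // _.
have [as_ _ _] := sfunP (s : section W).
rewrite (@euler_identity _ _ _ _ (fun j v => tfwd u v 0 j)) //.
  by have [->//|nl] := eqVneq (size l) n; rewrite (ds x l nl) !mulr0.
by move=> v; exact: frame_expand (Wu _ Wx).
Qed.

End SpecialSections.

(** * Morphisms of sheaves of sections are pull-backs *)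

Section SheafMorphism.
Variables (R : realType) (E F : vbundle R) (phi : vbase E -> vbase F).
Hypothesis sphi : smooth_map phi.
Variables (W : set (vbase F)).
Variable fs : forall V, @section_gcalg R F V -> @section_gcalg R E (phi @^-1` V).

(** A morphism from the restriction to [W] of $\Gamma(\wedge F^\vee)$ to
    $\varphi_\ast\Gamma(\wedge E^\vee)$. The open set [W] is there for changes of
    trivialisation, which are defined over overlaps only. *)
Definition sheaf_mor_over : Prop :=
  (forall V, open V -> V `<=` W -> gmorph (@fs V)) /\
  (forall V V' (V'V : V' `<=` V) (V'V1 : phi @^-1` V' `<=` phi @^-1` V),
     open V -> open V' -> V `<=` W ->
     forall s, fs (section_res V'V s) = section_res V'V1 (fs s)).

Hypotheses (oW : open W) (mfs : sheaf_mor_over).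

Lemma sheaf_mor_res V V' (V'V : V' `<=` V) s x l :
  open V -> open V' -> V `<=` W -> V' (phi x) ->
  (fs (section_res V'V s) : section _) x l = (fs s : section _) x l.
Proof.
move=> oV oV' VW V'x.
have V'V1 : phi @^-1` V' `<=` phi @^-1` V by move=> y /V'V.
by rewrite (mfs.2 _ _ V'V V'V1) // section_resE.
Qed.

Lemma smooth_section_nil V (s : @section R F V) : open V ->
  smooth_fun V (fun y => s y [::]).
Proof.
move=> oV; apply: smooth_local => x Vx; have [t vt tx] := v_cover x.
exists (V `&` tdom t) => //; have [_ _ ss] := sfunP s.
by have := ss t [::] vt; rewrite (interior_id _).1.
Qed.

(** A number $c = f^\sharp(s)(x)$ other than $s(\varphi(x))$ would make $s - c$
    invertible near $\varphi(x)$, hence its image invertible near $x$; but that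
    image vanishes at $x$. *)
Lemma sheaf_mor_deg0 V (s : @section_gcalg R F V) x :
  open V -> V `<=` W -> V (phi x) -> gdeg 0 s ->
  (fs s : section _) x [::] = (s : section _) (phi x) [::].
Proof.
move=> oV VW Vx ds; set c := (fs s : section _) x [::].
(* The value of (- c) *: 1 + s, the shape in which linearity is stated. *)
pose h y := - c * 1 + (s : section _) y [::].
have sh : smooth_fun V h.
  apply: smoothD => //; last exact: smooth_section_nil.
  by apply: smoothM => //; exact: smooth_cst.
apply/eqP/negPn/negP => nc.
pose V' := V `&` [set y | h y != 0].
have oV' : open V' by exact: open_smooth_neq0.
have V'V : V' `<=` V by move=> y [].
have V'x : V' (phi x) by split=> //=; rewrite /h mulr1 addrC subr_eq0 eq_sym.
have sV : smooth_fun V' (fun y => (h y)^-1).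
  by apply: smoothV => //; [move=> y []|exact: smooth_sub sh].
pose b : section_gcalg V' := func_section oV' sV.
pose a : section_gcalg V' := (- c) *: gone _ + section_res V'V s.
have ab1 : gmul a b = gone _.
  apply: section_ext_in => y l V'y.
  rewrite -[LHS]/(wedge ((a : section V') y) ((b : section V') y) l).
  have -> : (a : section V') y = fun r => h y * form1 r.
    apply/funext => r; rewrite [LHS]section_linE /= /h.
    case: asboolP => // _; rewrite mulrDl mulr1; congr (_ + _).
    by case: r => [|z r]; rewrite /form1 /= ?mulr1 // mulr0; exact: ds.
  have -> : (b : section V') y = fun r => (h y)^-1 * form1 r.
    by apply/funext => r /=; case: asboolP.
  rewrite wedgeZl wedgeZr wedge1l mulrA mulfV ?mul1r; last by case: V'y.
  by rewrite /=; case: asboolP.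
have [lf f1 fM _] := mfs.1 V' oV' (subset_trans V'V VW).
have := congr1 (fun w : section _ => w x [::]) (fM a b).
rewrite ab1 f1 /= {1}/a lf [X in _ = X * _]section_linE f1 (sheaf_mor_res V'V) //.
rewrite /=; case: asboolP => // _.
by rewrite /form1 /= mulr1 addNr mul0r => /eqP; rewrite oner_eq0.
Qed.

Section AtPoint.
Variables (x : vbase E) (u : triv (@vfib _ F) (vrank F)).
Hypotheses (vu : vtrivs u) (ux : tdom u (phi x)) (Wx : W (phi x)).

(** If $f^\sharp$ is to be the pull-back by $\Phi$, then the coordinates of $\Phi_x(v)$
    in the frame of [u] must be the numbers $f^\sharp(\epsilon^j)(x)(v)$. *)
Definition dual_map (v : vfib x) : vfib (phi x) :=
  \sum_j (fs (coframe j vu (@subIsetr _ W (tdom u))) : section _) x [:: v]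
     *: tframe u (phi x) j.

Lemma linear_dual_map : linear dual_map.
Proof.
move=> k v v'; rewrite /dual_map scaler_sumr -big_split /=.
apply: eq_bigr => j _; rewrite scalerA -scalerDl; congr (_ *: _).
set w := fs _; have [aw _ _] := sfunP (w : section _).
exact: ((aw x).1 [::] [::]).
Qed.

Lemma dual_map_coord v j : tfwd u (dual_map v) 0 j =
  (fs (coframe j vu (@subIsetr _ W (tdom u))) : section _) x [:: v].
Proof.
rewrite /dual_map (lin_sum _ _ (v_lin vu ux)) summxE (bigD1 j) //= big1.
  by rewrite addr0 mxE (v_bwdK vu ux) mxE !eqxx mulr1.
by move=> i ij; rewrite mxE (v_bwdK vu ux) mxE eqxx eq_sym (negbTE ij) mulr0.
Qed.

Let oD : open (W `&` tdom u).
Proof. by apply: openI => //; exact: v_open. Qed.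

Lemma dual_map_coframe V (Vu : V `<=` tdom u) j l :
  open V -> V `<=` W -> V (phi x) ->
  (fs (coframe j vu Vu) : section _) x l =
  (coframe j vu Vu : section _) (phi x) (map dual_map l).
Proof.
move=> oV VW Vx.
have VD : V `<=` W `&` tdom u by move=> y Vy; split; [exact: VW|exact: Vu].
have -> : coframe j vu Vu =
    section_res VD (coframe j vu (@subIsetr _ W (tdom u))).
  apply: section_ext_in => y s Vy; rewrite section_resE //=.
  by have Dy := VD _ Vy; do 2 case: asboolP => //.
rewrite section_resE //= sheaf_mor_res //; case: asboolP => [_|[]//].
have [_ _ _ fd] := mfs.1 _ oD (@subIsetl _ W (tdom u)).
have d1 := fd _ _ (coframe_deg j vu (@subIsetr _ W (tdom u))).
by case: l => [|v [|? ?]]; [apply: d1|rewrite /= dual_map_coord|apply: d1].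
Qed.

(** Both $f^\sharp$ and the pull-back by $\Phi$ are morphisms of algebras. By Euler's
    identity the elements of degree $0$ and the $\epsilon^j$ generate the algebra of
    sections over an open set contained in the domain of [u], so that it suffices
    to compare the two on these. *)
Lemma dual_map_homogeneous n V (s : @section_gcalg R F V) l :
  open V -> V `<=` W -> V `<=` tdom u -> V (phi x) -> gdeg n s ->
  (fs s : section _) x l = (s : section _) (phi x) (map dual_map l).
Proof.
move=> oV VW Vu Vx; have mf := mfs.1 V oV VW; have [lf f1 fM fd] := mf.
elim: n s l => [|n IH] s l ds.
  case: l => [|v l]; first exact: sheaf_mor_deg0.
  by rewrite (fd _ _ ds) // ds.
have n0 : n.+1%:R != 0 :> R by rewrite pnatr_eq0.
apply: (mulfI n0); rewrite -!section_scaleE.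
have -> : n.+1%:R *: (fs s : section _) = fs (n.+1%:R *: s) by rewrite gmorphZ.
have -> : n.+1%:R *: (s : section _) =
    \sum_j gmul (coframe j vu Vu) (contr_section j s vu Vu).
  exact: section_euler ds.
rewrite gmorph_sum //.
rewrite !section_bigE; apply: eq_bigr => j _.
rewrite fM [RHS]wedge_map /=; congr (wedge _ _ l); apply/funext => r.
  by rewrite dual_map_coframe.
by rewrite IH //; exact: contr_section_deg ds.
Qed.

Lemma dual_mapE V (s : @section_gcalg R F V) l :
  open V -> V `<=` W -> V (phi x) ->
  (fs s : section _) x l = (s : section _) (phi x) (map dual_map l).
Proof.
move=> oV VW Vx; pose V' := V `&` tdom u.
have oV' : open V' by apply: openI => //; exact: v_open.
have V'V : V' `<=` V by exact: subIsetl.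
have V'u : V' `<=` tdom u by exact: subIsetr.
have V'x : V' (phi x) by [].
rewrite -(sheaf_mor_res V'V) // -(section_resE V'V) //.
have [n [c [dc ->]]] := gdeg_span (section_res V'V s).
have V'W := subset_trans V'V VW.
rewrite (gmorph_sum _ (mfs.1 V' oV' V'W)) !section_bigE.
by apply: eq_bigr => k _; apply: dual_map_homogeneous (dc k).
Qed.

End AtPoint.

(** The matrix entries of $\Phi$ are smooth because they are the components of the
    sections $f^\sharp(\epsilon^j)$. *)
Lemma sheaf_mor_pullback : exists Phi : forall x, vfib x -> vfib (phi x),
  [/\ forall x, linear (Phi x),
      forall V (s : @section_gcalg R F V) x l,
        open V -> V `<=` W -> V (phi x) ->
        (fs s : section _) x l = (s : section _) (phi x) (map (Phi x) l) &
      forall (t : triv (@vfib _ E) (vrank E)) (u : triv (@vfib _ F) (vrank F)) i j,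
        vtrivs t -> vtrivs u ->
        smooth_fun (tdom t `&` phi @^-1` (W `&` tdom u))
          (fun x => tfwd u (Phi x (tframe t x i)) 0 j)].
Proof.
(* A trivialisation is chosen at each point; by dual_mapE the choice is immaterial. *)
pose Phi x : vfib x -> vfib (phi x) :=
  let: exist2 u vu _ := cid2 (v_cover (phi x)) in @dual_map x u vu.
have PhiE V (s : @section_gcalg R F V) x l : open V -> V `<=` W -> V (phi x) ->
    (fs s : section _) x l = (s : section _) (phi x) (map (Phi x) l).
  move=> oV VW Vx; rewrite /Phi; case: cid2 => u vu ux.
  by apply: dual_mapE => //; exact: VW.
exists Phi; split=> //.
  by move=> x; rewrite /Phi; case: cid2 => u vu _; exact: linear_dual_map.
move=> t u i j vt vu; set D := W `&` tdom u.
have oD : open D by apply: openI => //; exact: v_open.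
have [_ _ ss] := sfunP (fs (coframe j vu (@subIsetr _ W (tdom u))) : section _).
apply: (@smooth_ext _ _ _ _ _ _ _ (smooth_sub _ (ss t [:: i] vt))).
- by apply: openI; [exact: v_open|exact: open_preim].
- by move=> x [_ Dx]; rewrite /= PhiE //; exact: coframeE.
- by rewrite (interior_id _).1; [move=> y [ty Dy]|exact: open_preim].
Qed.

End SheafMorphism.

(** * The functor is fully faithful *)

Section FullyFaithful.
Variable R : realType.

Lemma shift_full (E F : vbundle R) (f : omor (shift_obj E) (shift_obj F)) :
  exists Phi : vmor E F, shift_hom Phi = f.
Proof.
case: f => phi fs P; have [sphi mfs nfs] := P.
pose gs V (s : @section_gcalg R F V) : @section_gcalg R E (phi @^-1` V) :=
  if pselect (open V) is left oV then fs V oV s else 0.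
have gsE V (oV : open V) : gs V = fs V oV.
  apply/funext => s; rewrite /gs; case: pselect => // oV'.
  by congr (fs V _ s); exact: Prop_irrelevance.
have mgs : sheaf_mor_over setT gs.
  split=> [V oV _|V V' V'V V'V1 oV oV' _ s]; first by rewrite gsE; exact: mfs.
  by rewrite !gsE; exact: nfs.
have [Phi [lPhi PhiE sPhi]] := sheaf_mor_pullback sphi openT mgs.
have vPhi : is_vmor Phi.
  split=> // t u i j vt vu; apply: smooth_sub (sPhi t u i j vt vu).
  by move=> x [].
exists (VMor vPhi); apply: omor_eq => V oV s; rewrite -gsE.
by apply: section_ext_in => x l Vx; rewrite PhiE.
Qed.

(** The sheaf maps of two equal morphisms live over underlying maps that are equal,
    not identical; the transport between them is along a proof that a map equals
    itself, hence trivial by proof irrelevance. *)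
Lemma omsharp_inj (X Y : onemfd R) (f : obody X -> obody Y)
    (fs gs : forall V, open V -> gsec (osheaf Y) V -> gsec (osheaf X) (f @^-1` V))
    (p : is_omor fs) (q : is_omor gs) : OMor p = OMor q -> fs = gs.
Proof.
have gen (a b : omor X Y) (e : a = b) (eb : ombase a = ombase b) :
    eq_rect (ombase a) (fun g : obody X -> obody Y =>
      forall V, open V -> gsec (osheaf Y) V -> gsec (osheaf X) (g @^-1` V))
      (@omsharp _ _ _ a) (ombase b) eb = @omsharp _ _ _ b.
  by case: b / e eb => eb; rewrite (Prop_irrelevance eb erefl).
by move=> /gen/(_ erefl).
Qed.

(** A fibrewise linear map is determined by the pull-backs of the sections
    $\epsilon^j$ of a dual frame. *)
Lemma shift_faithful (E F : vbundle R) (Phi Psi : vmor E F) :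
  shift_hom Phi = shift_hom Psi -> Phi = Psi.
Proof.
case: Phi Psi => phi Phi vPhi [psi Psi vPsi] ePP.
have ephi : phi = psi by exact: (congr1 (@ombase _ _ _) ePP).
case: psi / ephi Psi vPsi ePP => Psi vPsi /omsharp_inj ePP.
have {}ePP : Phi = Psi.
  apply: functional_extensionality_dep => x; apply/funext => v.
  have [u vu ux] := v_cover (phi x); apply: (can_inj (v_fwdK vu ux)).
  have ou := v_open vu.
  apply/rowP => j; pose eps := coframe j vu (@subset_refl _ (tdom u)).
  have := congr1 (fun h : (forall V : set (vbase F), open V ->
    @section_gcalg R F V -> @section_gcalg R E (phi @^-1` V)) => h _ ou eps) ePP.
  move=> /(congr1 (fun w : @section R E _ => w x [:: v])) /=.
  by case: asboolP.
by case: Psi / ePP vPsi => vPsi; exact: vmor_eq.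
Qed.

End FullyFaithful.

(** * Every graded manifold of degree one comes from a vector bundle *)

Section AssociatedBundle.
Variables (R : realType) (X : onemfd R).
Local Notation M := (obody X).
Local Notation C := (osheaf X).
Local Notation rV := 'rV[R]_(orank X).
Local Notation T := (trivial_vbundle M (orank X)).
Implicit Types (p q r x : M) (V W : set M).

(** [odom p] and [otriv p] are a trivialisation of [C] chosen around [p]. *)
Definition odom p : set M := projT1 (cid (oloc p)).

Lemma open_odom p : open (odom p).
Proof. by rewrite /odom; case: cid => U []. Qed.

Lemma open_setI_odom V p : open V -> open (V `&` odom p).
Proof. by move=> oV; apply: openI => //; exact: open_odom. Qed.

Lemma odom_self p : odom p p.
Proof. by rewrite /odom; case: cid => U []. Qed.

Lemma odom_iso p : sheaf_iso_on (odom p) C (section_sheaf T).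
Proof. by rewrite /odom; case: cid => U []. Qed.

Definition otriv p V : gsec C V -> @section_gcalg R T V :=
  projT1 (cid (odom_iso p)) V.

Lemma otriv_morph p V : open V -> V `<=` odom p -> gmorph (otriv p (V := V)).
Proof. by move=> oV Vp; have [] := (projT2 (cid (odom_iso p))).1 V oV Vp. Qed.

Lemma otriv_bij p V : open V -> V `<=` odom p -> bijective (otriv p (V := V)).
Proof. by move=> oV Vp; have [] := (projT2 (cid (odom_iso p))).1 V oV Vp. Qed.

Lemma otriv_res p V W (WV : W `<=` V) s : open V -> open W -> V `<=` odom p ->
  otriv p (gres WV s) = section_res (E := T) WV (otriv p s).
Proof.
by move=> oV oW Vp; exact: ((projT2 (cid (odom_iso p))).2 V W WV oV oW Vp s).
Qed.

Lemma otriv_resE p V W (WV : W `<=` V) s x l : open V -> open W ->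
  V `<=` odom p -> W x ->
  (otriv p (gres WV s) : section _) x l = (otriv p s : section _) x l.
Proof. by move=> oV oW Vp Wx; rewrite otriv_res // section_resE. Qed.

(** The coordinate forms are among the images of the elements of [C]. *)
Lemma otriv_separates p V x (v v' : rV) : open V -> V `<=` odom p -> V x ->
  (forall s : gsec C V,
     (otriv p s : section _) x [:: v] = (otriv p s : section _) x [:: v']) ->
  v = v'.
Proof.
move=> oV Vp Vx vv'; apply/rowP => j.
have VT : V `<=` tdom (trivial_triv M (orank X)) by [].
pose eps : @section_gcalg R T V := coframe (E := T) j erefl VT.
have [g _ gK] := otriv_bij oV Vp.
have := vv' (g eps); rewrite gK /=.
by case: asboolP.
Qed.

(** The change from the trivialisation at [q] to the one at [p] is a morphism of
    sheaves covering the identity, hence a pull-back. *)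
Lemma transition_exists q p : exists A : M -> rV -> rV,
  [/\ forall x, linear (A x),
      forall V (s : gsec C V) x l, open V -> V `<=` odom q `&` odom p -> V x ->
        (otriv p s : section _) x l = (otriv q s : section _) x (map (A x) l) &
      forall i j, smooth_fun (odom q `&` odom p)
        (fun x => A x (delta_mx 0 i) 0 j)].
Proof.
set W := odom q `&` odom p.
have oW : open W by apply: openI; exact: open_odom.
have Wq : W `<=` odom q by exact: subIsetl.
have Wp : W `<=` odom p by exact: subIsetr.
have inv_ex V : exists g : @section_gcalg R T V -> gsec C V, open V -> V `<=` W ->
    cancel (otriv q (V := V)) g /\ cancel g (otriv q (V := V)).
  have [[oV VW]|nV] := pselect (open V /\ V `<=` W).
    by have [g] := otriv_bij oV (subset_trans VW Wq); exists g.
  by exists (fun=> 0) => oV VW; case: nV.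
pose g V := projT1 (cid (inv_ex V)).
have gP V : open V -> V `<=` W ->
    cancel (otriv q (V := V)) (g V) /\ cancel (g V) (otriv q (V := V)).
  exact: projT2 (cid (inv_ex V)).
pose fs V (b : @section_gcalg R T V) : @section_gcalg R T (id @^-1` V) :=
  otriv p (g V b).
have mfs : @sheaf_mor_over R T T id W fs.
  split=> [V oV VW|V V' V'V V'V1 oV oV' VW s].
    have [gK Kg] := gP V oV VW.
    apply: (@gmorph_comp R _ _ _ (g V) (otriv p (V := V))).
      exact: gmorph_inv gK Kg (otriv_morph oV (subset_trans VW Wq)).
    exact: otriv_morph oV (subset_trans VW Wp).
  have V'W := subset_trans V'V VW.
  have [_ Kg] := gP V oV VW; have [gK' _] := gP V' oV' V'W.
  have gE : g V' (section_res V'V s) = gres V'V (g V s).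
    rewrite -[RHS]gK' (@otriv_res q) ?Kg //; exact: subset_trans VW Wq.
  have -> : V'V1 = V'V by exact: Prop_irrelevance.
  by rewrite /fs gE otriv_res //; exact: subset_trans VW Wp.
have [A [lA AE sA]] := @sheaf_mor_pullback R T T id (smooth_map_id _) W fs oW mfs.
exists A; split=> //.
  move=> V s x l oV VW Vx; have [gK _] := gP V oV VW.
  by have := AE V (otriv q s) x l oV VW Vx; rewrite /fs gK.
move=> i j; have := sA (trivial_triv _ _) (trivial_triv _ _) i j erefl erefl.
by apply: smooth_sub => x Wx; split.
Qed.

Definition transition q p : M -> rV -> rV := projT1 (cid (transition_exists q p)).

Lemma transition_linear q p x : linear (transition q p x).
Proof. by rewrite /transition; case: cid => A [] /=. Qed.

Lemma transition_smooth q p i j : smooth_fun (odom q `&` odom p)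
  (fun x => transition q p x (delta_mx 0 i) 0 j).
Proof. by rewrite /transition; case: cid => A [] /=. Qed.

Lemma transitionE q p V (s : gsec C V) x l :
  open V -> V `<=` odom q -> V `<=` odom p -> V x ->
  (otriv p s : section _) x l =
  (otriv q s : section _) x (map (transition q p x) l).
Proof.
rewrite /transition; case: cid => A [_ AE _] /= oV Vq Vp Vx.
by apply: AE => // y Vy; split; [exact: Vq|exact: Vp].
Qed.

Lemma transition_id p x v : odom p x -> transition p p x v = v.
Proof.
move=> px; apply: (otriv_separates (open_odom p) (@subset_refl _ _) px) => s.
by rewrite [RHS](@transitionE p p) //; exact: open_odom.
Qed.

(** Both sides pull the trivialisation at [p] back to the one at [r], and elements
    of degree one separate vectors. *)
Lemma transition_comp p q r x v : odom p x -> odom q x -> odom r x ->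
  transition p q x (transition q r x v) = transition p r x v.
Proof.
move=> px qx rx; pose V := odom p `&` (odom q `&` odom r).
have oV : open V by do 2?[apply: openI]; exact: open_odom.
have Vp : V `<=` odom p by move=> y [].
have Vq : V `<=` odom q by move=> y [? []].
have Vr : V `<=` odom r by move=> y [? []].
apply: (otriv_separates oV Vp (conj px (conj qx rx))) => s.
have Vx : V x by [].
have E1 := transitionE s [:: v] oV Vp Vr Vx.
have E2 := transitionE s [:: v] oV Vq Vr Vx.
have E3 := transitionE s [:: transition q r x v] oV Vp Vq Vx.
by move: E1 E2 E3 => /= <- -> <-.
Qed.

Lemma transitionK p q x : odom p x -> odom q x ->
  cancel (transition p q x) (transition q p x).
Proof. by move=> px qx v; rewrite transition_comp // transition_id. Qed.

(** The fibre at [x] is $\mathbb{R}^m$, seen as coordinates for the trivialisation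
    chosen at [x]; the trivialisation chosen at [p] acts on it by the change of
    coordinates. *)
Definition assoc_triv p : triv (fun _ : M => rV : lmodType R) (orank X) :=
  Triv (odom p) (fun x => transition p x x) (fun x => transition x p x).

Fact assoc_open t : range assoc_triv t -> open (tdom t).
Proof. by case=> p _ <-; exact: open_odom. Qed.

Fact assoc_cover x : exists2 t, range assoc_triv t & tdom t x.
Proof. by exists (assoc_triv x); [exists x|exact: odom_self]. Qed.

Fact assoc_lin t x : range assoc_triv t -> tdom t x -> linear (@tfwd _ _ _ _ t x).
Proof. by case=> p _ <- _; exact: transition_linear. Qed.

Fact assoc_fwdK t x : range assoc_triv t -> tdom t x ->
  cancel (@tfwd _ _ _ _ t x) (tbwd t x).
Proof. by case=> p _ <- px; apply: transitionK => //; exact: odom_self. Qed.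

Fact assoc_bwdK t x : range assoc_triv t -> tdom t x ->
  cancel (tbwd t x) (@tfwd _ _ _ _ t x).
Proof. by case=> p _ <- px; apply: transitionK => //; exact: odom_self. Qed.

Fact assoc_trans t t' i j : range assoc_triv t -> range assoc_triv t' ->
  smooth_fun (tdom t `&` tdom t') (fun x => tfwd t' (tframe t x i) 0 j).
Proof.
case=> p _ <- [q _ <-]; rewrite setIC.
apply: smooth_ext (transition_smooth q p i j).
  by apply: openI; exact: open_odom.
by move=> x [qx px]; rewrite /= transition_comp //; exact: odom_self.
Qed.

Definition assoc_bundle : vbundle R :=
  VBundle assoc_open assoc_cover assoc_lin assoc_fwdK assoc_bwdK assoc_trans.
Local Notation E := assoc_bundle.

Lemma assoc_trivP p : @vtrivs R E (assoc_triv p).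
Proof. by exists p. Qed.

(** The fibre at [x] consists of coordinates for the trivialisation chosen at [x], so
    in that trivialisation the value at [x] is read without change of coordinates. *)
Definition assoc_value V (s : gsec C V) x (l : seq rV) : R :=
  (otriv x (gres (@subIsetl _ V (odom x)) s) : section _) x l.

(** Any other trivialisation may be used, after a change of coordinates: both are
    compared over the intersection of [W] with the domain of the one at [x]. *)
Lemma assoc_valueE p V W (WV : W `<=` V) (s : gsec C V) x l :
  open V -> open W -> W `<=` odom p -> W x ->
  assoc_value s x l = (otriv p (gres WV s) : section _) x (map (transition p x x) l).
Proof.
move=> oV oW Wp Wx; pose W' := W `&` odom x.
have xx := odom_self x; have W'x : W' x by [].
have oW' : open W' by exact: open_setI_odom.
have oVx := open_setI_odom x oV.
have W'Vx : W' `<=` V `&` odom x by move=> y [/WV].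
have W'W : W' `<=` W by exact: subIsetl.
have W'V : W' `<=` V by move=> y [/WV].
rewrite /assoc_value -(otriv_resE W'Vx) //.
rewrite (gres_comp _ _ W'V) // -(gres_comp WV W'W W'V) //.
have W'p : W' `<=` odom p by exact: subset_trans W'W Wp.
have W'ox : W' `<=` odom x by exact: subIsetr.
by rewrite (transitionE _ _ oW' W'p W'ox W'x) otriv_resE.
Qed.

Fact assoc_section_subproof V (s : gsec C V) : open V ->
  @is_section R E V (assoc_value s).
Proof.
move=> oV; split.
- move=> x; rewrite /assoc_value; set w := otriv _ _.
  by have [aw _ _] := sfunP (w : section _); exact: aw.
- move=> x l Vx; rewrite /assoc_value; set w := otriv _ _.
  by have [_ zw _] := sfunP (w : section _); apply: zw => -[].
move=> _ I [p _ <-]; rewrite (interior_id _).1 //=.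
have oVp := open_setI_odom p oV.
pose w := otriv p (gres (@subIsetl _ V (odom p)) s).
have [_ _ sw] := sfunP (w : section _).
apply: (smooth_ext oVp _ (smooth_sub _ (sw (trivial_triv _ _) I erefl))).
  move=> x [Vx px].
  rewrite (assoc_valueE (@subIsetl _ V (odom p)) s _ oV oVp (@subIsetr _ _ _)) //.
  rewrite -map_comp; congr (_ x _); apply: eq_map => i.
  by rewrite /= /tframe /= transitionK //; exact: odom_self.
by move=> x Vx; split=> //; rewrite (interior_id _).1.
Qed.

Definition assoc_section V (oV : open V) (s : gsec C V) : @section_gcalg R E V :=
  Section (assoc_section_subproof s oV).

Lemma assoc_value_morph V x : open V ->
  gmorph (fun s => otriv x (gres (@subIsetl _ V (odom x)) s)).
Proof.
move=> oV; have oVx := open_setI_odom x oV.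
apply: (@gmorph_comp R _ _ _ (gres (@subIsetl _ V (odom x))) (otriv x (V := _))).
  exact: gres_morph.
by apply: otriv_morph => //; exact: subIsetr.
Qed.

Lemma assoc_value_lin V k (s s' : gsec C V) x l : open V ->
  assoc_value (k *: s + s') x l = k * assoc_value s x l + assoc_value s' x l.
Proof.
move=> /(assoc_value_morph x)[lf _ _ _]; rewrite /assoc_value lf.
exact: section_linE.
Qed.

Lemma assoc_value1 V x l : open V -> V x ->
  assoc_value (gone (gsec C V)) x l = form1 l.
Proof.
move=> /(assoc_value_morph x)[_ f1 _ _] Vx; rewrite /assoc_value f1 /=.
by case: asboolP => // -[]; split=> //; exact: odom_self.
Qed.

Lemma assoc_valueM V (s s' : gsec C V) x l : open V ->
  assoc_value (gmul s s') x l = wedge (assoc_value s x) (assoc_value s' x) l.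
Proof. by move=> /(assoc_value_morph x)[_ _ fM _]; rewrite /assoc_value fM. Qed.

Lemma assoc_section_morph V (oV : open V) : gmorph (assoc_section oV).
Proof.
split.
- move=> k a b; apply: section_ext_in => x l Vx; rewrite [RHS]section_linE.
  exact: assoc_value_lin.
- apply: section_ext_in => x l Vx; rewrite [LHS]assoc_value1 //=.
  by case: asboolP.
- by move=> a b; apply: section_ext_in => x l Vx; exact: assoc_valueM.
- by move=> n a da x; have [_ _ _ fd] := assoc_value_morph x oV; exact: fd n a da x.
Qed.

Lemma assoc_section_res V W (oV : open V) (oW : open W) (WV : W `<=` V) s :
  assoc_section oW (gres WV s) = section_res (E := E) WV (assoc_section oV s).
Proof.
apply: section_ext_in => x l Wx; rewrite section_resE //=.
have WxV : W `&` odom x `<=` V by move=> y [/WV].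
have oWx := open_setI_odom x oW.
have xx := odom_self x.
rewrite (@assoc_valueE x V _ WxV) // map_id_in; last first.
  by move=> v _; exact: transition_id.
by rewrite /assoc_value (gres_comp _ _ WxV).
Qed.

Lemma bigcup_odom V : V = \bigcup_p (V `&` odom p).
Proof.
apply/seteqP; split=> [x Vx|x [p _ []]//]; exists x => //; split=> //.
exact: odom_self.
Qed.

(** The values at the points of [odom p] determine the restriction to [odom p], and
    these restrictions determine the element. *)
Lemma assoc_section_inj V (oV : open V) : injective (assoc_section oV).
Proof.
move=> s s' ss'.
have oVp p := open_setI_odom p oV.
have sp p : gres (@subIsetl _ V (odom p)) s = gres (@subIsetl _ V (odom p)) s'.
  apply: (bij_inj (otriv_bij (oVp p) (@subIsetr _ V (odom p)))).
  apply: section_ext_in => x l [Vx px]; have xx := odom_self x.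
  have lE : l = map (transition p x x) (map (transition x p x) l).
    by rewrite -map_comp map_id_in // => v _ /=; rewrite transitionK.
  rewrite lE -!assoc_valueE //.
  exact: (congr1 (fun w : @section R E V => w x (map (transition x p x) l)) ss').
have [//|z [_ zu]] := @gglue _ _ C V M (fun p => V `&` odom p)
  (fun p => @subIsetl _ V (odom p)) (fun p => gres (@subIsetl _ V (odom p)) s)
  oVp (bigcup_odom V).
  move=> p q; have oI : open (V `&` odom p `&` (V `&` odom q)) by exact: openI.
  have IV : V `&` odom p `&` (V `&` odom q) `<=` V by move=> y [[]].
  by rewrite !(gres_comp _ _ IV).
by rewrite -(zu s) // -(zu s').
Qed.

(** A section of $\wedge E^\vee$ is read in each trivialisation, which gives
    elements of [C] that agree on the overlaps. *)
Lemma assoc_section_surj V (oV : open V) (b : @section_gcalg R E V) :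
  exists s, assoc_section oV s = b.
Proof.
have oVp p := open_setI_odom p oV.
pose Vl p := @subIsetl _ V (odom p); pose Vr p := @subIsetr _ V (odom p).
pose bp p : @section_gcalg R T (V `&` odom p) :=
  triv_fwd (assoc_trivP p) (Vr p) (section_res (E := E) (Vl p) b).
have bpE p x l : V x -> odom p x ->
    (bp p : section _) x l = (b : section _) x (map (transition x p x) l).
  move=> Vx px.
  rewrite [LHS](@triv_fwdE R E (assoc_triv p) (assoc_trivP p) _ (Vr p)) //.
  by rewrite section_resE.
have sp_ex p : exists s : gsec C (V `&` odom p), otriv p s = bp p.
  by have [g _ gK] := otriv_bij (oVp p) (Vr p); exists (g (bp p)).
pose sp p := projT1 (cid (sp_ex p)).
have spE p : otriv p (sp p) = bp p by exact: projT2 (cid (sp_ex p)).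
have [|s [sE _]] := @gglue _ _ C V M (fun p => V `&` odom p) Vl sp oVp (bigcup_odom V).
  move=> p q; set VI := V `&` odom p `&` (V `&` odom q).
  have oI : open VI by exact: openI.
  have Ip : VI `<=` odom p by move=> y [[]].
  have Iq : VI `<=` odom q by move=> y [_ []].
  apply: (bij_inj (otriv_bij oI Ip)).
  apply: section_ext_in => x l Ix; have [[Vx px] [_ qx]] := Ix.
  have xx := odom_self x.
  rewrite otriv_resE // spE bpE // (transitionE (q := q)) // otriv_resE // spE bpE //.
  rewrite -map_comp; congr (_ x _); apply: eq_map => v.
  by rewrite /= transition_comp.
exists s; apply: section_ext_in => x l Vx; have xx := odom_self x.
rewrite [LHS]/(assoc_value s x l) /= /assoc_value sE spE bpE // map_id_in // => v _.
exact: transition_id.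
Qed.

Lemma assoc_iso : exists (e : Defs.hom (shift1 R E) (X : ob (OneMan R))), is_iso e.
Proof.
have inv_ex V (oV : open V) : exists g : @section_gcalg R E V -> gsec C V,
    cancel (assoc_section oV) g /\ cancel g (assoc_section oV).
  have [g gP] := choice (assoc_section_surj oV).
  by exists g; split=> // s; apply: (@assoc_section_inj _ oV).
pose g V oV := projT1 (cid (@inv_ex V oV)).
have gK V oV : cancel (assoc_section oV) (g V oV) by exact: (projT2 (cid (inv_ex V oV))).1.
have Kg V oV : cancel (g V oV) (assoc_section oV) by exact: (projT2 (cid (inv_ex V oV))).2.
have Pe : @is_omor R (shift_obj E) X id assoc_section.
  split=> [|V oV|V W oV oW WV WV' s].
  - exact: smooth_map_id.
  - exact: assoc_section_morph.
  - have -> : WV' = WV by exact: Prop_irrelevance.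
    exact: assoc_section_res.
have Pg : @is_omor R X (shift_obj E) id g.
  split=> [|V oV|V W oV oW WV WV' s].
  - exact: smooth_map_id.
  - exact: gmorph_inv (gK V oV) (Kg V oV) (assoc_section_morph oV).
  - have -> : WV' = WV by exact: Prop_irrelevance.
    apply: (@assoc_section_inj _ oW).
    by rewrite Kg (assoc_section_res oV) Kg.
have gKo V (o o' : open V) : cancel (assoc_section o) (g V o').
  by rewrite (Prop_irrelevance o o').
have Kgo V (o o' : open V) : cancel (g V o') (assoc_section o).
  by rewrite (Prop_irrelevance o o').
by exists (OMor Pe), (OMor Pg); split; apply: omor_eq => V oV s;
  [exact: Kgo|exact: gKo].
Qed.

End AssociatedBundle.

(** * A criterion for equivalences of categories *)

Local Notation hom := Defs.hom.

Section EquivalenceCriterion.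
Variables (C D : category) (F : functor C D).
Hypothesis full : forall X Y (g : hom (F X) (F Y)), exists f, fhom F f = g.
Hypothesis faithful : forall X Y (f g : hom X Y), fhom F f = fhom F g -> f = g.
Hypothesis surj : forall Z : ob D, exists X (e : hom (F X) Z), is_iso e.

(** A quasi-inverse sends $Z$ to a chosen $X$ with $F X \cong Z$, and a morphism to
    the unique one whose image corresponds to it under these isomorphisms. *)
Lemma fully_faithful_surj_equivalence : is_equivalence F.
Proof.
pose G0 Z : ob C := projT1 (cid (surj Z)).
pose e Z : hom (F (G0 Z)) Z := projT1 (cid (projT2 (cid (surj Z)))).
have ie Z : is_iso (e Z) := projT2 (cid (projT2 (cid (surj Z)))).
pose e' Z : hom Z (F (G0 Z)) := projT1 (cid (ie Z)).
have e'K Z : compm (e' Z) (e Z) = idm _ := (projT2 (cid (ie Z))).1.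
have eK Z : compm (e Z) (e' Z) = idm _ := (projT2 (cid (ie Z))).2.
pose lift X Y (g : hom (F X) (F Y)) : hom X Y := projT1 (cid (full g)).
have liftK X Y (g : hom (F X) (F Y)) : fhom F (lift _ _ g) = g :=
  projT2 (cid (full g)).
pose G1 Y Z (g : hom Y Z) := lift _ _ (compm (e' Z) (compm g (e Y))).
have G1E Y Z (g : hom Y Z) : compm (e Z) (fhom F (G1 _ _ g)) = compm g (e Y).
  by rewrite liftK compmA eK comp1m.
have G1id Z : G1 Z Z (idm Z) = idm (G0 Z).
  by apply: faithful; rewrite liftK fhom1 comp1m e'K.
have G1comp X Y Z (g : hom Y Z) (f : hom X Y) :
    G1 _ _ (compm g f) = compm (G1 _ _ g) (G1 _ _ f).
  apply: faithful; rewrite fhomM !liftK !compmA.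
  by rewrite -(compmA _ (e Y) (e' Y)) eK compm1.
exists (Functor G1id G1comp); split.
- exists (fun X => lift _ _ (e (F X))); split=> [X|X Y f].
    exists (lift _ _ (e' (F X))).
    by split; apply: faithful; rewrite fhomM !liftK fhom1 ?eK ?e'K.
  by apply: faithful; rewrite !fhomM liftK /= G1E liftK.
- exists e; split; first exact: ie.
  by move=> X Y f; exact: G1E.
Qed.

End EquivalenceCriterion.

Theorem theorem1p3 (R : realType) : is_equivalence (shift1 R).
Proof.
apply: fully_faithful_surj_equivalence => [E F f|E F|X].
- exact: shift_full.
- exact: shift_faithful.
- by exists (assoc_bundle X); exact: assoc_iso.
Qed.
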